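(* In the setting described in the context, suppose $P=Z=U$ and let $v_0$ be a vertex of $U$. The equality $\bar{\mathrm r}(P_T)=\bar{\mathrm r}(U_T)=\bar{\mathrm r}(U)$ holds for every elementary deformation around $v_0$ by means of a tree $T$ if and only if the following condition holds. For every partition $D=A\vee B$ into nonempty subsets $A,B$, if the graph $\Psi(\{A,B\})$ has $k$ connected components, then there exists a partition $D=\bigvee_{i=1}^{k+1}C_i$ such that: (i) for every $i$, $C_i$ is nonempty and either $C_i\subseteq A$ or $C_i\subseteq B$; (ii) for every vertex $v\in VQ$, where $Q\in\{X,Y\}$, with $\beta_Q(v)=v_0$, the intersection $D(v)\cap A$ is either empty or $D(v)\cap A\subseteq C_{i_{vA}}$ for some $i_{vA}\in\{1,\dots,k+1\}$, and the intersection $D(v)\cap B$ is either empty or $D(v)\cap B\subseteq C_{i_{vB}}$ for some $i_{vB}\in\{1,\dots,k+1\}$.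
   Context: Graphs. For a finite graph $\Gamma$ with vertex set $V\Gamma$ and set of nonoriented edges $E\Gamma$ put $\bar{\mathrm r}(\Gamma) := |E\Gamma| - |V\Gamma|$. $\mathrm{core}(\Gamma)$ is the subgraph consisting of all edges lying on circuits (cyclically reduced closed paths of positive length) of $\Gamma$, together with their endpoints. For an oriented edge $e$, $e_-$ and $e_+$ are its initial and terminal vertices. $\vee$, $\bigvee$ denote disjoint unions. Setting. $U$ is a finite connected graph without vertices of degree 1, $F=\pi_1(U)$ is free; $H,K$ are finitely generated subgroups of $F$. $X$ and $Y$ are the (core) Stallings graphs of $H$ and $K$: the cores of the coverings of $U$ corresponding to $H$, $K$, with the induced locally injective maps $\varphi_X:X\to U$, $\varphi_Y:Y\to U$. $S(H,K)$ is a set of representatives of the double cosets $HtK$, $t\in F$, with $H\cap tKt^{-1}\ne\{1\}$. Connected components $W_t$ of $\mathrm{core}(X\times_U Y)$, where $X\times_U Y$ is the pullback of $\varphi_X,\varphi_Y$, correspond bijectively to $t\in S(H,K)$. For nonempty $S_1\subseteq S(H,K)$, $W(S_1)$ is the disjoint union of the $W_s$, $s\in S_1$; $\alpha_X:W(S_1)\to X$, $\alpha_Y:W(S_1)\to Y$ are the restrictions of the pullback projections; $P=X\vee_{W(S_1)}Y$ is the pushout of $\alpha_X,\alpha_Y$ with pushout maps $\beta_X:X\to P$, $\beta_Y:Y\to P$. $Z$ is the Stallings graph of $\langle H,K,S_1\rangle$, and $\gamma:P\to Z$, $\delta:Z\to U$ are the natural graph maps, with $\delta\gamma\beta_X=\varphi_X$,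 $\delta\gamma\beta_Y=\varphi_Y$. ''$P=Z=U$'' means that $\gamma$ and $\delta$ are isomorphisms, by which $P,Z,U$ are identified (so $\gamma,\delta$ are identity maps and $\varphi_X=\beta_X$, $\varphi_Y=\beta_Y$). Elementary deformation around $v\in VU$ by means of a tree $T$. Subdivide edges incident to $v$ (and correspondingly their preimages in the other graphs) so that the oriented edges $e$ with $e_+=v$ have pairwise distinct initial vertices $e_-$ of degree 2; these edges form a star $\mathrm{St}(v)$ with center $v$ and $\deg v$ rays. Let $T$ be a finite tree whose degree-1 vertices are in bijection with those of $\mathrm{St}(v)$. $U_T$ is obtained from $U$ by removing $\mathrm{St}(v)$ and gluing in $T$ along this bijection. Lift this to $Q\in\{X,Y,W(S_1),Z\}$: for each vertex $u$ of $Q$ mapped to $v$, the star around $u$ is replaced by a copy of the minimal subtree of $T$ containing the degree-1 vertices of $T$ corresponding to the images in $\mathrm{St}(v)$ of the edges at $u$. This yields $X_T,Y_T,W(S_1)_T,Z_T$ with induced maps, and the new pushout $P_T=X_T\vee_{W(S_1)_T}Y_T$. Notation for the condition. $D$ is the set of all oriented edges of $U$ that end in $v_0$. A vertex of $X$, $Y$ or $W(S_1)$ is a $v_0$-vertex if its image in $U$ under $\beta_X$, $\beta_Y$ or $\beta_X\alpha_X$, respectively, is $v_0$. For a $v_0$-vertex $v$ of $Q\in\{X,Y,W(S_1)\}$, $D(v)\subseteq D$ is the set of those $e\in D$ that are images of oriented edges $f$ of $Q$ with $f_+=v$. Given a partition $D=A\vee B$ with $A,B$ nonempty, a $v_0$-vertex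 $v$ is of type $\{A,B\}$ if both $D(v)\cap A$ and $D(v)\cap B$ are nonempty; $V_{\{A,B\}}Q$ is the set of vertices of $Q$ of type $\{A,B\}$. $\Psi(\{A,B\})$ is the bipartite graph with vertex set the disjoint union $V_{\{A,B\}}X\vee V_{\{A,B\}}Y$, in which $v_X\in V_{\{A,B\}}X$ and $v_Y\in V_{\{A,B\}}Y$ are joined by an edge if and only if there is $v\in V_{\{A,B\}}W(S_1)$ with $\alpha_X(v)=v_X$ and $\alpha_Y(v)=v_Y$. *)

(* Defs.v *)
From HB Require Import structures.
From mathcomp Require Import all_boot ssralg ssrint.

Set Implicit Arguments.
Unset Strict Implicit.
Unset Printing Implicit Defensive.

(* Graphs in the sense of Serre: [dart G] is the set of oriented edges, with a
   fixed-point-free orientation reversal; a nonoriented edge is a pair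
   {e, inv e}.  Coverings of finite graphs may be infinite, hence the carriers
   are arbitrary types. *)
Record graph := Graph {
  vert : Type;
  dart : Type;
  inv : dart -> dart;
  ini : dart -> vert;
  invK : forall e, inv (inv e) = e;
  inv_neq : forall e, inv e <> e
}.

Definition ter (G : graph) (e : dart G) : vert G := ini (inv e).

Record fin_graph := FinGraph {
  fvert : finType;
  fdart : finType;
  finv : fdart -> fdart;
  fini : fdart -> fvert;
  finvK : forall e, finv (finv e) = e;
  finv_neq : forall e, finv e <> e
}.

Coercion graph_of (G : fin_graph) : graph :=
  @Graph (fvert G) (fdart G) (@finv G) (@fini G) (@finvK G) (@finv_neq G).

Definition fter (G : fin_graph) (e : fdart G) : fvert G := fini (finv e).

Section FiniteInvariants.
Variable G : fin_graph.

Definition degree (v : fvert G) : nat := #|[pred e : fdart G | fini e == v]|.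

Definition rbar : int := (#|fdart G|./2%:Z - #|fvert G|%:Z)%R.

End FiniteInvariants.

Section Paths.
Variable G : graph.
Implicit Types (u v : vert G) (p : seq (dart G)).

Fixpoint walk u p v : Prop :=
  if p is e :: p' then ini e = u /\ walk (ter e) p' v else u = v.

Definition connected : Prop :=
  inhabited (vert G) /\ forall u v, exists p, walk u p v.

Definition reduced p : Prop :=
  forall p1 e p2, p <> p1 ++ e :: inv e :: p2.

Definition cyc_reduced p : Prop := reduced (p ++ p).

Definition circuit p : Prop :=
  [/\ p <> [::], exists v, walk v p v & cyc_reduced p].

Definition core_dart (e : dart G) : Prop :=
  exists p1 p2, circuit (p1 ++ e :: p2).

Definition core_vert v : Prop := exists2 e, core_dart e & ini e = v.

Definition is_tree : Prop := connected /\ forall p, ~ circuit p.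

End Paths.

Record hom (G1 G2 : graph) := Hom {
  hv :> vert G1 -> vert G2;
  hd : dart G1 -> dart G2;
  hom_ini : forall e, ini (hd e) = hv (ini e);
  hom_inv : forall e, hd (inv e) = inv (hd e)
}.

Lemma hom_ter (G1 G2 : graph) (f : hom G1 G2) e : ter (hd f e) = f (ter e).
Proof. by rewrite /ter -hom_inv hom_ini. Qed.

Definition hom_id (G : graph) : hom G G :=
  @Hom G G id id (fun=> erefl) (fun=> erefl).

Lemma hom_comp_ini (G1 G2 G3 : graph) (g : hom G2 G3) (f : hom G1 G2) e :
  ini (hd g (hd f e)) = g (f (ini e)).
Proof. by rewrite !hom_ini. Qed.

Lemma hom_comp_inv (G1 G2 G3 : graph) (g : hom G2 G3) (f : hom G1 G2) e :
  hd g (hd f (inv e)) = inv (hd g (hd f e)).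
Proof. by rewrite !hom_inv. Qed.

Definition hom_comp (G1 G2 G3 : graph) (g : hom G2 G3) (f : hom G1 G2) :
    hom G1 G3 :=
  @Hom G1 G3 (g \o f) (hd g \o hd f) (hom_comp_ini g f) (hom_comp_inv g f).

Definition hom_eq (G1 G2 : graph) (f g : hom G1 G2) : Prop :=
  f =1 g /\ hd f =1 hd g.

Definition hom_iso (G1 G2 : graph) (f : hom G1 G2) : Prop :=
  bijective f /\ bijective (hd f).

Definition embeds_onto (G1 G2 : graph) (f : hom G1 G2)
    (PV : vert G2 -> Prop) (PD : dart G2 -> Prop) : Prop :=
  [/\ injective f, injective (hd f),
      forall v, PV v <-> exists u, f u = v &
      forall e, PD e <-> exists d, hd f d = e].

Definition covering (C B : graph) (p : hom C B) : Prop :=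
  (forall v, exists c, p c = v) /\
  forall c e, ini e = p c -> exists! d, ini d = c /\ hd p d = e.

Section FundamentalGroup.
Variables (U : fin_graph) (o : fvert U).
Implicit Types p q : seq (fdart U).

Definition red_cons (e : fdart U) p :=
  if p is f :: p' then if f == finv e then p' else e :: p else [:: e].

(* The reduced path homotopic to p. *)
Definition red p : seq (fdart U) := foldr red_cons [::] p.

Definition reducedb p : bool := sorted (fun e f => f != finv e) p.

Fixpoint fwalk (u : fvert U) p (v : fvert U) : bool :=
  if p is e :: p' then (fini e == u) && fwalk (fter e) p' v else u == v.

Lemma fwalkP u p v : reflect (walk (G := U) u p v) (fwalk u p v).
Proof.
elim: p u => [|e p IHp] u /=; first exact: eqP.
apply: (iffP andP) => [[/eqP ? /IHp ?]|[? /IHp ?]]; split=> //.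
exact/eqP.
Qed.

Lemma red_cons_reduced e p : reducedb p -> reducedb (red_cons e p).
Proof.
case: p => [//|f p]; rewrite /reducedb /= => fp.
by case: eqP => [_|/eqP nf] /=; [exact: path_sorted fp | rewrite nf].
Qed.

Lemma red_reduced p : reducedb (red p).
Proof. by elim: p => //= e p; exact: red_cons_reduced. Qed.

Lemma red_id p : reducedb p -> red p = p.
Proof.
elim: p => // e p IHp; rewrite /reducedb /= => ep.
rewrite IHp; last exact: path_sorted ep.
by case: p ep {IHp} => //= f p /andP[/negbTE ->].
Qed.

Lemma red_consK e p : reducedb p -> red_cons e (red_cons (finv e) p) = p.
Proof.
case: p => [|f p] /=; first by rewrite eqxx.
rewrite finvK /reducedb /=; case: eqP => [->|_] /=; last by rewrite eqxx.
by case: p => //= g p /andP[/negbTE ->].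
Qed.

Lemma foldr_red_reduced p q : reducedb q -> reducedb (foldr red_cons q p).
Proof. by move=> rq; elim: p => //= e p; exact: red_cons_reduced. Qed.

Lemma foldr_red p q : reducedb q -> foldr red_cons q (red p) = foldr red_cons q p.
Proof.
move=> rq; elim: p => //= e p <-.
case: (red p) => //= f r; case: eqP => // -> /=.
by rewrite red_consK // foldr_red_reduced.
Qed.

Lemma red_catl p q : red (red p ++ q) = red (p ++ q).
Proof. by rewrite /red !foldr_cat foldr_red // red_reduced. Qed.

Lemma red_catr p q : red (p ++ red q) = red (p ++ q).
Proof. by rewrite /red !foldr_cat -/(red (red q)) red_id // red_reduced. Qed.

Lemma fwalk_cat u p q v w : fwalk u p v -> fwalk v q w -> fwalk u (p ++ q) w.
Proof.
elim: p u => [|e p IHp] u /=; first by move/eqP->.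
by case/andP=> -> /IHp; apply.
Qed.

Lemma red_cons_walk e p v : fwalk (fter e) p v -> fwalk (fini e) (red_cons e p) v.
Proof.
case: p => [|f p] /=; first by rewrite eqxx.
case/andP=> /eqP fe fp; case: eqP => [ef|_] /=; last by rewrite eqxx fe eqxx.
by move: fp; rewrite ef /fter finvK.
Qed.

Lemma red_walk u p v : fwalk u p v -> fwalk u (red p) v.
Proof.
by elim: p u => //= e p IHp u /andP[/eqP <- /IHp]; exact: red_cons_walk.
Qed.

Definition rev_path p := rev (map (@finv U) p).

Lemma rev_path_walk u p v : fwalk u p v -> fwalk v (rev_path p) u.
Proof.
elim: p u => [|e p IHp] u /=; first by rewrite eq_sym.
case/andP=> /eqP <- /IHp pv; rewrite /rev_path /= rev_cons -cats1.
by apply: fwalk_cat pv _; rewrite /= /fter finvK !eqxx.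
Qed.

Lemma rev_pathK : involutive rev_path.
Proof.
by move=> p; rewrite /rev_path map_rev revK mapK //; exact: finvK.
Qed.

Lemma red_revl p : red (rev_path p ++ p) = [::].
Proof.
elim: p => //= e p IHp; rewrite /rev_path /= rev_cons -cats1 -catA /=.
rewrite /red foldr_cat /= -/(red p).
by have := red_consK (finv e) (red_reduced p); rewrite finvK => ->;
   rewrite -IHp /red foldr_cat.
Qed.

Lemma red_revr p : red (p ++ rev_path p) = [::].
Proof. by rewrite -{1}[p]rev_pathK red_revl. Qed.

Definition pi1_pred p : bool := fwalk o p o && reducedb p.

(* The group pi_1(U, o): reduced closed paths at o, multiplied by concatenating
   and reducing. *)
Record pi1 := Pi1 { pi1_path :> seq (fdart U); _ : pi1_pred pi1_path }.

HB.instance Definition _ := [isSub for pi1_path].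
HB.instance Definition _ := [Choice of pi1 by <:].

Lemma pi1_one_subproof : pi1_pred [::].
Proof. by rewrite /pi1_pred /= eqxx. Qed.

Lemma pi1_mul_subproof (x y : pi1) : pi1_pred (red (x ++ y)).
Proof.
case: x y => [p /andP[po _]] [q /andP[qo _]] /=.
by rewrite /pi1_pred red_reduced red_walk // (fwalk_cat po).
Qed.

Lemma pi1_inv_subproof (x : pi1) : pi1_pred (red (rev_path x)).
Proof.
case: x => [p /andP[po _]] /=.
by rewrite /pi1_pred red_reduced red_walk // rev_path_walk.
Qed.

Definition pi1_one := Pi1 pi1_one_subproof.
Definition pi1_mul x y := Pi1 (pi1_mul_subproof x y).
Definition pi1_inv x := Pi1 (pi1_inv_subproof x).

Lemma pi1_red (x : pi1) : red x = x.
Proof. by case: x => p /= /andP[_]; exact: red_id. Qed.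

Lemma pi1_mulA : associative pi1_mul.
Proof. by move=> x y z; apply: val_inj; rewrite /= red_catr red_catl catA. Qed.

Lemma pi1_mul1 : left_id pi1_one pi1_mul.
Proof. by move=> x; apply: val_inj; rewrite /= pi1_red. Qed.

Lemma pi1_mulr1 : right_id pi1_one pi1_mul.
Proof. by move=> x; apply: val_inj; rewrite /= cats0 pi1_red. Qed.

Lemma pi1_mulV : left_inverse pi1_one pi1_inv pi1_mul.
Proof. by move=> x; apply: val_inj; rewrite /= red_catl red_revl. Qed.

Lemma pi1_mulVr : right_inverse pi1_one pi1_inv pi1_mul.
Proof. by move=> x; apply: val_inj; rewrite /= red_catr red_revr. Qed.

HB.instance Definition _ := isGroup.Build pi1
  pi1_mulA pi1_mul1 pi1_mulr1 pi1_mulV pi1_mulVr.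

End FundamentalGroup.

Section Subgroups.
Variable F : groupType.
Implicit Types (H K M S : F -> Prop) (s t : F).
Local Open Scope group_scope.

Definition subgroup H : Prop := H 1 /\ forall x y, H x -> H y -> H (x * y^-1).

Definition generated S : F -> Prop :=
  fun x => forall M, subgroup M -> (forall s, S s -> M s) -> M x.

Definition fin_generated H : Prop :=
  exists r : seq F, forall x, H x <-> generated (fun y => y \in r) x.

Definition nontrivial_meet H K t : Prop :=
  exists x, [/\ x <> 1, H x & exists2 k, K k & x = t * k * t^-1].

Definition double_coset H K s : F -> Prop :=
  fun t => exists h k, [/\ H h, K k & t = h * s * k].

(* S is a possible choice of S(H, K). *)
Definition dcoset_reps H K S : Prop :=
  (forall s, S s -> nontrivial_meet H K s) /\
  forall t, nontrivial_meet H K t -> exists! s, S s /\ double_coset H K s t.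

End Subgroups.

(* The core Stallings graph of a subgroup H of pi_1(U, o): [cover] is the
   covering of U corresponding to H, that is, a path of U at o lifts to a closed
   path at [base] iff it represents an element of H; the graph itself is
   (a finite graph identified by [core_in] with) the core of [cover]. *)
Record stallings (U : fin_graph) (o : fvert U) (H : pi1 o -> Prop) := Stallings {
  cover : graph;
  cover_map : hom cover U;
  base : vert cover;
  cover_covering : covering cover_map;
  cover_connected : connected cover;
  cover_base : cover_map base = o;
  cover_group : forall g : pi1 o,
    H g <-> exists2 p, walk base p base & map (hd cover_map) p = pi1_path g;
  core_graph :> fin_graph;
  core_in : hom core_graph cover;
  core_inP : embeds_onto core_in (@core_vert cover) (@core_dart cover)
}.

Definition stallings_map (U : fin_graph) (o : fvert U) (H : pi1 o -> Prop)
    (X : stallings H) : hom X U :=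
  hom_comp (cover_map X) (core_in X).

(* The natural map between the Stallings graphs of subgroups H <= L is the
   restriction of the morphism of the pointed coverings. *)
Definition natural_map (U : fin_graph) (o : fvert U) (H L : pi1 o -> Prop)
    (X : stallings H) (Z : stallings L) (f : hom X Z) : Prop :=
  exists c : hom (cover X) (cover Z),
    [/\ c (base X) = base Z, hom_eq (hom_comp (cover_map Z) c) (cover_map X) &
        hom_eq (hom_comp c (core_in X)) (hom_comp (core_in Z) f)].

Section Pullback.
Variables (G1 G2 : graph) (B : fin_graph) (f : hom G1 B) (g : hom G2 B).

Definition pb_vert := {x : vert G1 * vert G2 | (f x.1 : fvert B) == g x.2}.
Definition pb_dart := {x : dart G1 * dart G2 | (hd f x.1 : fdart B) == hd g x.2}.

Lemma pb_inv_subproof (e : pb_dart) :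
  (hd f (inv (val e).1) : fdart B) == hd g (inv (val e).2).
Proof. by rewrite !hom_inv (eqP (valP e)). Qed.

Lemma pb_ini_subproof (e : pb_dart) :
  (f (ini (val e).1) : fvert B) == g (ini (val e).2).
Proof. by rewrite -!hom_ini (eqP (valP e)). Qed.

Definition pb_inv (e : pb_dart) : pb_dart :=
  exist _ (inv (val e).1, inv (val e).2) (pb_inv_subproof e).
Definition pb_ini (e : pb_dart) : pb_vert :=
  exist _ (ini (val e).1, ini (val e).2) (pb_ini_subproof e).

Lemma pb_invK e : pb_inv (pb_inv e) = e.
Proof. by apply: val_inj; case: e => [[d1 d2] ?]; rewrite /= !invK. Qed.

Lemma pb_inv_neq e : pb_inv e <> e.
Proof. by move/(congr1 val); case: e => [[d1 d2] ?] /= [/inv_neq]. Qed.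

Definition pullback : graph := Graph pb_ini pb_invK pb_inv_neq.

Definition pb_fst : hom pullback G1 :=
  @Hom pullback G1 (fun x => (val x).1) (fun e => (val e).1)
    (fun=> erefl) (fun=> erefl).
Definition pb_snd : hom pullback G2 :=
  @Hom pullback G2 (fun x => (val x).2) (fun e => (val e).2)
    (fun=> erefl) (fun=> erefl).

End Pullback.

Section FiberProduct.
Variables (U : fin_graph) (o : fvert U) (H K : pi1 o -> Prop).
Variables (X : stallings H) (Y : stallings K).

Notation XUY := (pullback (stallings_map X) (stallings_map Y)).

(* If a and b are paths of the coverings from the base points to x and to y,
   whose images in U end at the same vertex, then H [a] [b]^-1 K is the double
   coset corresponding to the component of the pullback containing (x, y); it
   contains t iff a and b can be chosen so that [a] = t [b]. *)
Definition corresponds (t : pi1 o) (v : vert XUY) : Prop :=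
  exists a b,
    [/\ walk (base X) a (core_in X (val v).1),
        walk (base Y) b (core_in Y (val v).2) &
        red (map (hd (cover_map X)) a)
        = red (pi1_path t ++ map (hd (cover_map Y)) b)].

(* W(S1), the union of the components W_s of core(XUY) with s in S1. *)
Record fiber_core (S1 : pi1 o -> Prop) := FiberCore {
  fiber_graph :> fin_graph;
  fiber_in : hom fiber_graph XUY;
  fiber_inP : embeds_onto fiber_in
    (fun v => core_vert v /\ exists2 s, S1 s & corresponds s v)
    (fun e => core_dart e /\ exists2 s, S1 s & corresponds s (ini e))
}.

Definition alphaX (S1 : pi1 o -> Prop) (W : fiber_core S1) : hom W X :=
  hom_comp (pb_fst _ _) (fiber_in W).
Definition alphaY (S1 : pi1 o -> Prop) (W : fiber_core S1) : hom W Y :=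
  hom_comp (pb_snd _ _) (fiber_in W).

Lemma alpha_square (S1 : pi1 o -> Prop) (W : fiber_core S1) :
  hom_eq (hom_comp (stallings_map X) (alphaX W))
         (hom_comp (stallings_map Y) (alphaY W)).
Proof.
split=> [w|e] /=; apply/eqP; first exact: (valP (fiber_in W w)).
exact: (valP (hd (fiber_in W) e)).
Qed.

End FiberProduct.

Section GluedSum.
Variables (A B C : finType) (f : C -> A) (g : C -> B).

Definition glue : rel (A + B) := fun x y =>
  [exists c, ((x == inl (f c)) && (y == inr (g c)))
          || ((x == inr (g c)) && (y == inl (f c)))].

Lemma glue_sym : connect_sym glue.
Proof.
apply: sym_connect_sym => x y.
by apply/existsP/existsP=> -[c xy]; exists c; move: xy; rewrite orbC andbC
  [X in _ || X]andbC.
Qed.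

(* The quotient of A + B by the equivalence relation generated by
   inl (f c) ~ inr (g c); a class is represented by its [root]. *)
Definition glued : finType := {x : A + B | roots glue x}.

Definition glued_class (x : A + B) : glued :=
  exist _ (root glue x) (roots_root glue_sym x).

Lemma glued_eqP (c : C) : glued_class (inl (f c)) = glued_class (inr (g c)).
Proof.
apply: val_inj; apply/(rootP glue_sym)/connect1/existsP.
by exists c; rewrite !eqxx.
Qed.

Lemma glued_classK (x : glued) : glued_class (val x) = x.
Proof. by apply: val_inj; exact/eqP/(valP x). Qed.

Lemma glued_compat (T : Type) (h : A + B -> T) :
  (forall c, h (inl (f c)) = h (inr (g c))) ->
  forall x, h (val (glued_class x)) = h x.
Proof.
move=> hc x; have /= := connect_root glue x.
case/connectP=> p + ->; elim: p x => //= y p IHp x /andP[/existsP[c xy] /IHp ->].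
by case/orP: xy => /andP[/eqP-> /eqP->].
Qed.

End GluedSum.

Section Pushout.
Variables (W X Y B : fin_graph) (a : hom W X) (b : hom W Y).
Variables (f : hom X B) (g : hom Y B).
Hypothesis sq : hom_eq (hom_comp f a) (hom_comp g b).

Notation po_vert := (glued (a : fvert W -> fvert X) (b : fvert W -> fvert Y)).
Notation po_dart :=
  (glued (hd a : fdart W -> fdart X) (hd b : fdart W -> fdart Y)).

Definition sum_inv (e : fdart X + fdart Y) : fdart X + fdart Y :=
  match e with inl d => inl (finv d) | inr d => inr (finv d) end.
Definition sum_ini (e : fdart X + fdart Y) : fvert X + fvert Y :=
  match e with inl d => inl (fini d) | inr d => inr (fini d) end.
Definition sum_hd (e : fdart X + fdart Y) : fdart B :=
  match e with inl d => hd f d | inr d => hd g d end.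

Definition po_vclass : fvert X + fvert Y -> po_vert := @glued_class _ _ _ _ _.
Definition po_dclass : fdart X + fdart Y -> po_dart := @glued_class _ _ _ _ _.

Definition po_inv (e : po_dart) : po_dart := po_dclass (sum_inv (val e)).
Definition po_ini (e : po_dart) : po_vert := po_vclass (sum_ini (val e)).

Lemma po_invE x : po_inv (po_dclass x) = po_dclass (sum_inv x).
Proof.
rewrite /po_inv /po_dclass.
apply: (glued_compat (h := fun y => glued_class _ _ (sum_inv y))) => c /=.
have /= <- := hom_inv a c; have /= <- := hom_inv b c.
exact: (glued_eqP _ _ (finv c)).
Qed.

Lemma po_iniE x : po_ini (po_dclass x) = po_vclass (sum_ini x).
Proof.
rewrite /po_ini /po_dclass /po_vclass.
apply: (glued_compat (h := fun y => glued_class _ _ (sum_ini y))) => c /=.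
have /= -> := hom_ini a c; have /= -> := hom_ini b c.
exact: (glued_eqP _ _ (fini c)).
Qed.

Lemma po_invK e : po_inv (po_inv e) = e.
Proof.
rewrite {2}/po_inv po_invE -[RHS]glued_classK /po_dclass.
by congr glued_class; case: (val e) => d /=; rewrite finvK.
Qed.

Lemma po_inv_neq e : po_inv e <> e.
Proof.
move/(congr1 (fun x => sum_hd (val x))).
rewrite /po_inv /po_dclass glued_compat => [|c]; last exact: (sq.2 c).
case: (val e) => d /=.
  have /= -> := hom_inv f d; exact: finv_neq.
have /= -> := hom_inv g d; exact: finv_neq.
Qed.

(* The pushout of a and b.  The commutative square over the graph B is needed
   only to know that no edge of the pushout is identified with its inverse. *)
Definition pushout : fin_graph := FinGraph po_ini po_invK po_inv_neq.

Definition po_inl : hom X pushout :=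
  @Hom X pushout (fun x => po_vclass (inl x)) (fun e => po_dclass (inl e))
    (fun e => po_iniE (inl e)) (fun e => esym (po_invE (inl e))).
Definition po_inr : hom Y pushout :=
  @Hom Y pushout (fun y => po_vclass (inr y)) (fun e => po_dclass (inr e))
    (fun e => po_iniE (inr e)) (fun e => esym (po_invE (inr e))).

End Pushout.

Section BasicPushout.
Variables (U : fin_graph) (o : fvert U) (H K S1 : pi1 o -> Prop).
Variables (X : stallings H) (Y : stallings K) (W : fiber_core X Y S1).

Definition pushout_P : fin_graph := pushout (alpha_square W).
Definition betaX : hom X pushout_P := po_inl (alpha_square W).
Definition betaY : hom Y pushout_P := po_inr (alpha_square W).

Definition join_group : pi1 o -> Prop :=
  generated (fun g => H g \/ K g \/ S1 g).

Definition P_eq_Z_eq_U (Z : stallings join_group) : Prop :=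
  (exists gamma : hom pushout_P Z,
     [/\ natural_map (hom_comp gamma betaX),
         natural_map (hom_comp gamma betaY) & hom_iso gamma]) /\
  hom_iso (stallings_map Z).

End BasicPushout.

(* In this section f stands for the map of Q = X, Y or W(S1) to U; when
   P = Z = U the maps beta_X and beta_Y are identified with the Stallings maps
   of X and Y. *)
Section VertexStar.
Variables (U : fin_graph) (v0 : fvert U).

Definition star : {set fdart U} := [set e | fter e == v0].

Definition local_star (Q : fin_graph) (f : hom Q U) (v : fvert Q) :
    {set fdart U} :=
  [set e in star | [exists d : fdart Q, (fter d == v) && (hd f d == e)]].

Definition is_v0_vertex (Q : fin_graph) (f : hom Q U) (v : fvert Q) : bool :=
  f v == v0 :> fvert U.

Definition of_type (A B : {set fdart U}) (Q : fin_graph) (f : hom Q U)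
    (v : fvert Q) : bool :=
  [&& is_v0_vertex f v, local_star f v :&: A != set0
    & local_star f v :&: B != set0].

(* Every nonempty intersection of a local star with A or with B lies in a single
   class C i. *)
Definition compatible (k : nat) (C : 'I_k -> {set fdart U})
    (A B : {set fdart U}) (Q : fin_graph) (f : hom Q U) : Prop :=
  forall v : fvert Q, is_v0_vertex f v ->
    (local_star f v :&: A = set0 \/
       exists i, local_star f v :&: A \subset C i) /\
    (local_star f v :&: B = set0 \/
       exists i, local_star f v :&: B \subset C i).

End VertexStar.

(* The bipartite graph Psi({A,B}). *)
Section Psi.
Variables (U : fin_graph) (o : fvert U) (H K S1 : pi1 o -> Prop).
Variables (X : stallings H) (Y : stallings K) (W : fiber_core X Y S1).
Variables (v0 : fvert U) (A B : {set fdart U}).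

Definition type_X (x : fvert X) := of_type v0 A B (stallings_map X) x.
Definition type_Y (y : fvert Y) := of_type v0 A B (stallings_map Y) y.
Definition type_W (w : fvert W) :=
  of_type v0 A B (hom_comp (stallings_map X) (alphaX W)) w.

Definition psi_vert : finType := ({x | type_X x} + {y | type_Y y})%type.

Definition psi_joined (x : fvert X) (y : fvert Y) : bool :=
  [exists w : fvert W, [&& type_W w, alphaX W w == x :> fvert X
                                  & alphaY W w == y :> fvert Y]].

Definition psi_edge : rel psi_vert := fun z1 z2 =>
  match z1, z2 with
  | inl x, inr y | inr y, inl x => psi_joined (val x) (val y)
  | _, _ => false
  end.

Definition psi_components : nat := n_comp psi_edge predT.

End Psi.

(* A finite tree T whose degree-1 vertices are in bijection with the rays of the
   star of v0, that is, with the oriented edges of U that end in v0.  The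
   values of [leaf] at other edges are irrelevant. *)
Record deformation_tree (U : fin_graph) (v0 : fvert U) := DeformationTree {
  tree_graph :> fin_graph;
  tree_is_tree : is_tree tree_graph;
  leaf : fdart U -> fvert tree_graph;
  leaf_inj : {in star v0 &, injective leaf};
  leafP : forall t, (degree t == 1) = (t \in [set leaf e | e in star v0])
}.

Section Hull.
Variable T : fin_graph.

Definition adjacent (x y : fvert T) : bool :=
  [exists e, (fini e == x) && (fter e == y)].

(* In a tree, the subtrees are the subgraphs induced by these vertex sets. *)
Definition conn_set (S : {set fvert T}) : bool :=
  [forall x in S, forall y in S,
     connect (fun u v => [&& adjacent u v, u \in S & v \in S]) x y].

Definition hull (L : {set fvert T}) : {set fvert T} :=
  \bigcap_(S : {set fvert T} | conn_set S && (L \subset S)) S.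

Lemma sub_hull (L : {set fvert T}) : L \subset hull L.
Proof. by apply/bigcapsP => S /andP[]. Qed.

Lemma hullS (L M : {set fvert T}) : L \subset M -> hull L \subset hull M.
Proof.
move=> LM; apply/bigcapsP => S /andP[cS MS].
by apply: bigcap_inf; rewrite cS (subset_trans LM MS).
Qed.

End Hull.

(* Replacing the stars around the vertices of Q over v0 by subtrees of T.
   After every oriented edge e of U ending in v0 has been subdivided near v0 by
   a new vertex (so a loop at v0 is subdivided twice), the rays of the star of
   v0 join these vertices to v0.  Removing the star and gluing in T amounts to
   deleting v0 and the rays and identifying the subdivision vertex of e with
   [leaf T e].  So the remaining part of e is an edge that ends in [leaf T e];
   it is denoted by e again.  In Q, each vertex u over v0 is deleted in the same
   way, and a copy of the subtree of T with the vertex set [S u] is glued in. *)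
Section Splice.
Variables (U : fin_graph) (v0 : fvert U) (T : deformation_tree v0).
Variables (Q : fin_graph) (f : hom Q U) (S : fvert Q -> {set fvert T}).
Hypothesis leafS : forall e : fdart Q,
  f (fter e) = v0 -> leaf T (hd f e) \in S (fter e).

Definition splice_vert_pred (z : fvert Q + fvert Q * fvert T) : bool :=
  match z with
  | inl u => ~~ is_v0_vertex v0 f u
  | inr (u, t) => is_v0_vertex v0 f u && (t \in S u)
  end.
Definition splice_dart_pred (z : fdart Q + fvert Q * fdart T) : bool :=
  match z with
  | inl _ => true
  | inr (u, e) =>
    [&& is_v0_vertex v0 f u, fini e \in S u & fter e \in S u]
  end.

Definition splice_vert : finType := {z | splice_vert_pred z}.
Definition splice_dart : finType := {z | splice_dart_pred z}.

Definition raw_inv (z : fdart Q + fvert Q * fdart T) :=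
  match z with
  | inl e => inl (finv e)
  | inr (u, e) => inr (u, finv e)
  end.
Definition raw_ini (z : fdart Q + fvert Q * fdart T) :=
  match z with
  | inl e => if is_v0_vertex v0 f (fini e)
             then inr (fini e, leaf T (hd f (finv e))) else inl (fini e)
  | inr (u, e) => inr (u, fini e)
  end.

Lemma splice_inv_subproof (e : splice_dart) : splice_dart_pred (raw_inv (val e)).
Proof.
case: e => [[e|[u e]]] //= /and3P[-> ei et].
by move: et; rewrite /fter finvK ei => ->.
Qed.

Lemma splice_ini_subproof (e : splice_dart) : splice_vert_pred (raw_ini (val e)).
Proof.
case: e => [[e|[u e]]] /= => [_|/and3P[-> -> _] //].
case: ifP => [v0e|/negbT //] /=; rewrite v0e /=.
have := @leafS (finv e); rewrite /fter finvK; apply; exact/eqP.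
Qed.

Definition splice_inv (e : splice_dart) : splice_dart :=
  exist _ (raw_inv (val e)) (splice_inv_subproof e).
Definition splice_ini (e : splice_dart) : splice_vert :=
  exist _ (raw_ini (val e)) (splice_ini_subproof e).

Lemma splice_invK e : splice_inv (splice_inv e) = e.
Proof. by apply: val_inj; case: e => [[e|[u e]] ?]; rewrite /= finvK. Qed.

Lemma splice_inv_neq e : splice_inv e <> e.
Proof.
by move/(congr1 val); case: e => [[e|[u e]] ?] /= [/finv_neq].
Qed.

Definition splice : fin_graph := FinGraph splice_ini splice_invK splice_inv_neq.

End Splice.

Section SpliceMap.
Variables (U : fin_graph) (v0 : fvert U) (T : deformation_tree v0).
Variables (Q R : fin_graph) (g : hom Q U) (f : hom R U) (a : hom Q R).
Variables (SQ : fvert Q -> {set fvert T}) (SR : fvert R -> {set fvert T}).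
Hypothesis leafQ : forall e : fdart Q,
  g (fter e) = v0 -> leaf T (hd g e) \in SQ (fter e).
Hypothesis leafR : forall e : fdart R,
  f (fter e) = v0 -> leaf T (hd f e) \in SR (fter e).
Hypothesis fa : hom_eq (hom_comp f a) g.
Hypothesis subS : forall u, SQ u \subset SR (a u).

Definition raw_vmap (z : fvert Q + fvert Q * fvert T) :
    fvert R + fvert R * fvert T :=
  match z with inl u => inl (a u) | inr (u, t) => inr (a u : fvert R, t) end.
Definition raw_dmap (z : fdart Q + fvert Q * fdart T) :
    fdart R + fvert R * fdart T :=
  match z with inl e => inl (hd a e) | inr (u, e) => inr (a u : fvert R, e) end.

Lemma over_v0 u : is_v0_vertex v0 f (a u) = is_v0_vertex v0 g u.
Proof. by rewrite /is_v0_vertex -(fa.1 u). Qed.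

Lemma splice_vmap_subproof (z : splice_vert g SQ) :
  splice_vert_pred f SR (raw_vmap (val z)).
Proof.
case: z => [[u|[u t]]] /=; rewrite over_v0 // => /andP[-> /=].
exact: (subsetP (subS u)).
Qed.

Lemma splice_dmap_subproof (z : splice_dart g SQ) :
  splice_dart_pred f SR (raw_dmap (val z)).
Proof.
case: z => [[e|[u e]]] //=; rewrite over_v0 => /and3P[-> ei et] /=.
by rewrite !(subsetP (subS u)).
Qed.

Definition splice_vmap (z : splice_vert g SQ) : splice_vert f SR :=
  exist _ (raw_vmap (val z)) (splice_vmap_subproof z).
Definition splice_dmap (z : splice_dart g SQ) : splice_dart f SR :=
  exist _ (raw_dmap (val z)) (splice_dmap_subproof z).

Lemma splice_map_ini (e : dart (splice leafQ)) :
  ini (g := splice leafR) (splice_dmap e) = splice_vmap (ini e).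
Proof.
apply: val_inj; case: e => [[e|[u e]] ez] //=.
have /= -> := hom_ini a e; rewrite over_v0; case: ifP => //= _.
have /= <- := hom_inv a e; by have /= -> := fa.2 (finv e).
Qed.

Lemma splice_map_inv (e : dart (splice leafQ)) :
  splice_dmap (inv e) = inv (g := splice leafR) (splice_dmap e).
Proof.
apply: val_inj; case: e => [[e|[u e]] ez] //=.
by have /= -> := hom_inv a e.
Qed.

Definition splice_map : hom (splice leafQ) (splice leafR) :=
  Hom splice_map_ini splice_map_inv.

End SpliceMap.

Section Deformation.
Variables (U : fin_graph) (v0 : fvert U) (T : deformation_tree v0).

Definition deform_U_subproof (e : fdart U) :
  hom_id U (fter e) = v0 -> leaf T (hd (hom_id U) e) \in [set: fvert T] :=
  fun=> in_setT _.

Definition deform_U : fin_graph := splice (S := fun=> setT) deform_U_subproof.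

(* The minimal subtree of T spanned by the edges at u. *)
Definition local_tree (Q : fin_graph) (f : hom Q U) (u : fvert Q) :
    {set fvert T} :=
  hull [set leaf T e | e in local_star v0 f u].

Lemma deform_subproof (Q : fin_graph) (f : hom Q U) (e : fdart Q) :
  f (fter e) = v0 -> leaf T (hd f e) \in local_tree f (fter e).
Proof.
move=> fe; apply: (subsetP (sub_hull _)); apply: imset_f.
have /= := hom_ter f e; rewrite /ter /= -/(fter e) fe => he.
rewrite !inE /fter he eqxx /=.
by apply/existsP; exists e; rewrite !eqxx.
Qed.

Definition deform (Q : fin_graph) (f : hom Q U) : fin_graph :=
  splice (deform_subproof (f := f)).

Lemma local_star_sub (Q R : fin_graph) (g : hom Q U) (f : hom R U) (a : hom Q R) :
  hom_eq (hom_comp f a) g ->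
  forall u, local_star v0 g u \subset local_star v0 f (a u).
Proof.
move=> fa u; apply/subsetP=> e; rewrite !inE => /andP[-> /existsP[d]] /=.
case/andP=> /eqP <- /eqP <-; apply/existsP; exists (hd a d).
have /= -> := fa.2 d; rewrite eqxx andbT.
by have /= := hom_ter a d; rewrite /ter /fter /= => ->.
Qed.

Lemma local_tree_sub (Q R : fin_graph) (g : hom Q U) (f : hom R U) (a : hom Q R) :
  hom_eq (hom_comp f a) g ->
  forall u, local_tree g u \subset local_tree f (a u).
Proof. by move=> fa u; apply/hullS/imsetS/local_star_sub. Qed.

Definition deform_map (Q R : fin_graph) (g : hom Q U) (f : hom R U) (a : hom Q R)
    (fa : hom_eq (hom_comp f a) g) : hom (deform g) (deform f) :=
  splice_map _ _ fa (local_tree_sub fa).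

Lemma hom_comp_id (Q : fin_graph) (f : hom Q U) :
  hom_eq (hom_comp (hom_id U) f) f.
Proof. by []. Qed.

Definition deform_to_U (Q : fin_graph) (f : hom Q U) : hom (deform f) deform_U :=
  splice_map (deform_subproof (f := f)) deform_U_subproof (hom_comp_id f)
    (fun u => subsetT (local_tree f u)).

Section DeformedPushout.
Variables (W X Y : fin_graph) (a : hom W X) (b : hom W Y).
Variables (f : hom X U) (g : hom Y U).
Hypothesis sq : hom_eq (hom_comp f a) (hom_comp g b).

Definition deform_a : hom (deform (hom_comp f a)) (deform f) :=
  deform_map (conj (frefl _) (frefl _)).
Definition deform_b : hom (deform (hom_comp f a)) (deform g) :=
  deform_map (conj (fsym sq.1) (fsym sq.2)).

Lemma deform_square :
  hom_eq (hom_comp (deform_to_U f) deform_a) (hom_comp (deform_to_U g) deform_b).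
Proof.
by split=> -[[z|[u z]] zP]; apply: val_inj => /=;
  [have /= -> := sq.1 z | have /= -> := sq.1 u
  |have /= -> := sq.2 z | have /= -> := sq.1 u].
Qed.

End DeformedPushout.

Variables (o : fvert U) (H K S1 : pi1 o -> Prop).
Variables (X : stallings H) (Y : stallings K) (W : fiber_core X Y S1).

Definition deform_P : fin_graph := pushout (deform_square (alpha_square W)).

End Deformation.

(* Main.v *)
From mathcomp Require Import all_boot ssralg ssrint zify.
Require Import Defs.

Set Implicit Arguments.
Unset Strict Implicit.
Unset Printing Implicit Defensive.

(** Write [P_T] for the deformed pushout and [F] for the set of its darts that
    come from copies of [T].  Contracting [F] turns [P_T] back into [P = U]:
    two vertices of [P_T] are joined by [F] exactly when they lie over the same
    vertex of [U], so that [F] has [#|VU|] components ([comps_tree_darts]), and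
    the remaining darts of [P_T] are those of [U] ([card_po_darts]).  Because
    [T] is a tree, [rbar (U_T) = rbar U] always holds ([rbar_deform_U]), while
    [rbar (P_T) = rbar U] says that [#|V(P_T)| = #|VU| + #|F| / 2]
    ([rbar_po]).  A graph has at least (vertices - edges) components, with
    equality exactly for forests, so this equality says that [F] is a forest,
    that is, that every dart of [F] is a bridge of [F].

    Bridges can be tested one edge [e] of [T] at a time.  The edge [e] cuts [T]
    into two sides, hence the star of [v0] into [A] and [B].  The copy of a
    subtree at [u] contains [e] exactly when the local star of [u] meets both
    [A] and [B], that is, when [u] has type {A,B}; therefore the edges of [P_T]
    over [e] are the connected components of Psi({A,B})
    ([n_comp_type_edge]).  Deleting these [k] edges from the part of [P_T] over
    [v0], which is connected, leaves at most [k + 1] components, with equality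
    exactly when all of them are bridges.

    If classes [C_i] as in the condition are given, then a point of the copy of
    a subtree at [u] can be labelled by the class that contains the part of the
    local star of [u] on its side of [e].  Gluing and moving along darts other
    than those over [e] preserve the label, and all [k + 1] labels occur, so
    that there are at least [k + 1] components ([leq_comps_avoid]) and [F] is a
    forest.  Conversely, if [F] is a forest, then there are exactly [k + 1]
    components, and the class of an element of the star of [v0] is the component
    of the corresponding leaf ([exists_classes]).  Every partition {A,B} comes
    from an edge of some tree, namely from the central edge of a double star
    ([double_star_exists]). *)

(** * Counting the components of a set of darts *)

Section ComponentCount.
Variables (V V' : finType) (e : rel V) (h : V -> V').
Hypothesis e_sym : connect_sym e.

(** A function that is constant on components separates at most as many points
    as there are components. *)
Lemma leq_image_n_comp :
  (forall x y, e x y -> h x = h y) -> #|h @: [set: V]| <= n_comp e predT.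
Proof.
move=> he.
have hroot x : h (root e x) = h x.
  case/connectP: (connect_root e x) => p + ->.
  by elim: p x => //= y p IHp x /andP[/he -> /IHp].
apply: leq_trans (leq_imset_card h (predI (roots e) predT)).
apply/subset_leq_card/subsetP=> _ /imsetP[x _ ->].
by rewrite -hroot imset_f // inE /= roots_root.
Qed.

Lemma n_comp_image :
  (forall x y, connect e x y = (h x == h y)) ->
  n_comp e predT = #|h @: [set: V]|.
Proof.
move=> he; apply/eqP; rewrite eqn_leq leq_image_n_comp ?andbT; last first.
  by move=> x y xy; apply/eqP; rewrite -he connect1.
rewrite /n_comp_mem -(card_in_imset (f := h)); last first.
  move=> x y; rewrite !inE !andbT => /eqP rx /eqP ry /eqP.
  by rewrite -he => /(rootP e_sym); rewrite rx ry.
by apply/subset_leq_card/subsetP=> _ /imsetP[x _ ->]; rewrite imset_f.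
Qed.

End ComponentCount.

Section DartSets.
Variable G : fin_graph.
Implicit Types (S : {set fdart G}) (d : fdart G) (x y : fvert G).

Definition inv_closed S := forall d, (finv d \in S) = (d \in S).

Definition dlink S : rel (fvert G) :=
  fun x y => [exists d in S, (fini d == x) && (fter d == y)].

Definition comps S := n_comp (dlink S) predT.

(** The darts come in inverse pairs, so removing an edge removes two darts. *)
Definition unlink S d := S :\ d :\ finv d.

Lemma fter_inv d : fter (finv d) = fini d.
Proof. by rewrite /fter finvK. Qed.

Lemma finv_eq d d' : (finv d == d') = (d == finv d').
Proof. exact/can2_eq/finvK/finvK. Qed.

Lemma finv_neqb d : (finv d == d) = false.
Proof. exact/eqP/finv_neq. Qed.

Lemma dlinkP S x y :
  reflect (exists d, [/\ d \in S, fini d = x & fter d = y]) (dlink S x y).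
Proof.
apply: (iffP exists_inP) => [[d dS /andP[/eqP ? /eqP ?]]|[d [dS <- <-]]].
  by exists d.
by exists d; rewrite ?eqxx.
Qed.

Lemma dlink_dart S d : d \in S -> dlink S (fini d) (fter d).
Proof. by move=> dS; apply/dlinkP; exists d. Qed.

Lemma dlink_connect_sym S : inv_closed S -> connect_sym (dlink S).
Proof.
move=> cS; apply: sym_connect_sym => x y.
by apply/dlinkP/dlinkP=> -[d [dS <- <-]]; exists (finv d); rewrite cS fter_inv.
Qed.

Lemma connect_dlinkS S S' :
  S \subset S' -> subrel (connect (dlink S)) (connect (dlink S')).
Proof.
move=> SS'; apply: connect_sub => _ _ /dlinkP[d [dS <- <-]].
by apply/connect1/dlink_dart/(subsetP SS').
Qed.

Lemma in_unlink S d d' :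
  (d' \in unlink S d) = [&& d' != finv d, d' != d & d' \in S].
Proof. by rewrite !inE. Qed.

Lemma unlink_inv S d : unlink S (finv d) = unlink S d.
Proof. by rewrite /unlink finvK setDDl setUC -setDDl. Qed.

Lemma unlink_closed S d : inv_closed S -> inv_closed (unlink S d).
Proof.
move=> cS d'; rewrite !in_unlink cS !finv_eq finvK.
by rewrite andbCA.
Qed.

Lemma unlink_sub S d : unlink S d \subset S.
Proof. by apply/subsetP=> d'; rewrite in_unlink => /and3P[]. Qed.

Lemma card_unlink S d : inv_closed S -> d \in S -> #|S| = (#|unlink S d|).+2.
Proof.
move=> cS dS; rewrite (cardsD1 d) dS (cardsD1 (finv d)) !inE cS dS andbT.
by rewrite finv_neqb.
Qed.

Section Unlink.
Variables (S : {set fdart G}) (d : fdart G).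
Hypotheses (cS : inv_closed S) (dS : d \in S).
Let S' := unlink S d.
Let S'sym : connect_sym (dlink S') := dlink_connect_sym (unlink_closed d cS).

(** A path that uses the removed edge can be shortened so as to use it once, in
    one of the two directions. *)
Lemma connect_unlink x y :
  connect (dlink S) x y =
  [|| connect (dlink S') x y,
      connect (dlink S') x (fini d) && connect (dlink S') (fter d) y |
      connect (dlink S') x (fter d) && connect (dlink S') (fini d) y].
Proof.
have sub := connect_dlinkS (unlink_sub S d).
apply/idP/idP; last first.
  case/or3P=> [/sub //|/andP[/sub xd /sub dy]|/andP[/sub xd /sub dy]].
    by apply: connect_trans (connect_trans xd _) dy; exact/connect1/dlink_dart.
  apply: connect_trans (connect_trans xd _) dy; rewrite -fter_inv.
  by apply/connect1/dlink_dart; rewrite cS.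
case/connectP=> p + ->; elim: p x => [|z p IHp] x /=; first by rewrite connect0.
case/andP=> /dlinkP[d' [d'S <- <-]] /IHp {IHp}.
case: (boolP (d' \in S')) => [/dlink_dart/connect1 xz|].
  by case/or3P=> [/(connect_trans xz)->//|/andP[/(connect_trans xz)-> ->]|
                /andP[/(connect_trans xz)-> ->]]; rewrite ?orbT.
rewrite in_unlink d'S andbT -negb_or negbK => /orP[]/eqP->.
  rewrite fter_inv; case/or3P=> [->|/andP[_ ->]|/andP[_ ->]];
  by rewrite ?connect0 ?orbT.
case/or3P=> [->|/andP[_ ->]|/andP[_ ->]];
by rewrite ?connect0 ?orbT.
Qed.

Lemma comps_unlink_nonbridge :
  connect (dlink S') (fini d) (fter d) -> comps S' = comps S.
Proof.
move=> br; apply: eq_n_comp => x y; rewrite connect_unlink.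
apply/idP/or3P=> [|[//|/andP[xd dy]|/andP[xd dy]]]; first by constructor.
  exact: connect_trans (connect_trans xd br) dy.
by apply: connect_trans (connect_trans xd _) dy; rewrite S'sym.
Qed.

(** The classes of the two ends of [d] merge; in terms of representatives, the
    root of the class of [fter d] disappears from the transversal. *)
Lemma comps_unlink_bridge :
  ~~ connect (dlink S') (fini d) (fter d) -> comps S' = (comps S).+1.
Proof.
move=> br; pose r := root (dlink S') (fter d).
have symS := dlink_connect_sym cS.
have rr : r \in predI (roots (dlink S')) predT.
  by rewrite !inE andbT; exact: roots_root.
rewrite /comps /n_comp_mem (cardD1 r) rr add1n; congr _.+1.
rewrite -(card_in_imset (f := root (dlink S))); last first.
  move=> x y; rewrite !inE !andbT => /andP[xr /eqP rx] /andP[yr /eqP ry].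
  move/(rootP symS); rewrite connect_unlink.
  have nr z : z != r -> root (dlink S') z = z -> ~~ connect (dlink S') z (fter d).
    by move=> zr rz; apply: contra zr => /(rootP S'sym) zd; rewrite /r -zd rz.
  case/or3P=> [/(rootP S'sym)|/andP[_]|/andP[+ _]]; first by rewrite rx ry.
    by rewrite S'sym (negPf (nr y yr ry)).
  by rewrite (negPf (nr x xr rx)).
apply: eq_card => x; rewrite !inE andbT; apply/imsetP/eqP=> [[z _ ->]|rx].
  by rewrite root_root.
have [xr|nxr] := boolP (connect (dlink S') x (fter d)); last first.
  exists (root (dlink S') x).
    rewrite !inE roots_root // !andbT; apply: contra nxr => /eqP.
    by move/(rootP S'sym).
  rewrite -{1}rx; apply/(rootP symS)/(connect_dlinkS (unlink_sub S d)).
  exact: connect_root.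
exists (root (dlink S') (fini d)).
  rewrite !inE roots_root // !andbT; apply: contra br => /eqP.
  by move/(rootP S'sym).
rewrite -{1}rx; apply/(rootP symS).
rewrite connect_unlink xr connect_root !orbT //.
Qed.

End Unlink.

(** Induction that rebuilds an inverse-closed set of darts from a given subset,
    one edge at a time. *)
Lemma inv_closed_ind (P : {set fdart G} -> Prop) S0 :
  inv_closed S0 -> P S0 ->
  (forall S d, inv_closed S -> S0 \subset unlink S d -> d \in S ->
    P (unlink S d) -> P S) ->
  forall S, inv_closed S -> S0 \subset S -> P S.
Proof.
move=> c0 P0 IH S; have [n] := ubnP #|S|; elim: n S => // n IHn S.
move=> Sn cS S0S; have [-> //|] := eqVneq S S0.
rewrite eqEsubset S0S andbT => /subsetPn[d dS dS0].
have sub : S0 \subset unlink S d.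
  by rewrite !subsetD1 S0S dS0 c0.
apply: (IH S d) => //; apply: IHn => //; last exact: unlink_closed.
by move: Sn; rewrite (card_unlink cS dS); lia.
Qed.

(** Each added edge, which is a pair of darts, reduces the number of components
    by at most one.  Everything is doubled in order to count darts instead of
    edges. *)
Lemma comps_leq S' S : inv_closed S' -> inv_closed S -> S' \subset S ->
  (comps S').*2 + #|S'| <= (comps S).*2 + #|S|.
Proof.
move=> c' cS sub; move: S cS sub; apply: inv_closed_ind => // S d cS _ dS IH.
apply: leq_trans IH _; rewrite (card_unlink cS dS).
have [br|br] := boolP (connect (dlink (unlink S d)) (fini d) (fter d)).
  by rewrite (comps_unlink_nonbridge cS dS br); lia.
by rewrite (comps_unlink_bridge cS dS br); lia.
Qed.

Lemma inv_closed0 : inv_closed set0.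
Proof. by move=> d; rewrite !inE. Qed.

Lemma inv_closedT : inv_closed setT.
Proof. by move=> d; rewrite !inE. Qed.

Lemma comps0 : comps set0 = #|fvert G|.
Proof.
rewrite /comps (@n_comp_image _ _ _ id) ?imset_id ?cardsT //.
  exact/dlink_connect_sym/inv_closed0.
move=> x y; apply/idP/eqP=> [|->//].
by case/connectP=> -[//|z p] /= /andP[/dlinkP[d []]]; rewrite inE.
Qed.

(** If every edge is a bridge, then each edge reduces the number of components by
    exactly one, also when the edges are added one by one, because a bridge of
    [S] is a bridge of every subset that contains it. *)
Lemma comps_forest S : inv_closed S ->
  (forall d, d \in S -> ~~ connect (dlink (unlink S d)) (fini d) (fter d)) ->
  #|fvert G|.*2 = (comps S).*2 + #|S|.
Proof.
rewrite -comps0 => cS; move: S cS (sub0set S).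
apply: inv_closed_ind; rewrite ?cards0 ?addn0 //; first exact: inv_closed0.
move=> S d cS _ dS IH br; rewrite IH.
  by rewrite (comps_unlink_bridge cS dS (br d dS)) (card_unlink cS dS); lia.
move=> d' /(subsetP (unlink_sub S d)) /br; apply: contra.
by apply/connect_dlinkS/setSD/setSD/unlink_sub.
Qed.

Lemma card_inv_closed S : inv_closed S -> ~~ odd #|S|.
Proof.
move=> cS; move: S cS (sub0set S).
apply: inv_closed_ind; rewrite ?cards0 //; first exact: inv_closed0.
by move=> S d cS _ dS; rewrite (card_unlink cS dS) /= negbK.
Qed.

(** A family [E] whose removal creates one component per edge consists of
    bridges: an edge of [E] that is not a bridge could be removed first at no
    gain, and the remaining edges would not be enough. *)
Lemma bridge_of_comps S E d : inv_closed S -> inv_closed E -> E \subset S ->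
  (comps S).*2 + #|E| <= (comps (S :\: E)).*2 -> d \in E ->
  ~~ connect (dlink (unlink S d)) (fini d) (fter d).
Proof.
move=> cS cE ES le dE; apply/negP=> br.
have dS := subsetP ES d dE.
have := comps_unlink_nonbridge cS dS br.
have cSE : inv_closed (S :\: E) by move=> d'; rewrite !inE cS cE.
have sub : S :\: E \subset unlink S d.
  by rewrite !subsetD1 subsetDl !inE cE dE.
have := comps_leq cSE (unlink_closed d cS) sub.
have := card_unlink cS dS; have := cardsD S E; rewrite (setIidPr ES).
have := subset_leq_card ES; move: le; lia.
Qed.

(** The edges that do not separate [x] from [y] can be removed one by one
    without disconnecting [x] from [y]. *)
Lemma connect_separating S x y : inv_closed S ->
  connect (dlink S) x y -> forall S', inv_closed S' -> S' \subset S ->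
  (forall d, d \in S -> connect (dlink (unlink S d)) x (fini d) ->
     connect (dlink (unlink S d)) (fter d) y -> d \in S') ->
  connect (dlink S') x y.
Proof.
move=> cS xy S' cS' sub; move: xy; move: S cS sub.
apply: inv_closed_ind => // S d cS sub dS IH xy sep.
have [ndS'] : d \notin S' /\ finv d \notin S'.
  by move: sub; rewrite !subsetD1 cS' => /andP[/andP[]].
have cd : inv_closed (unlink S d) by apply: unlink_closed.
have sd d' : connect (dlink (unlink (unlink S d) d')) x (fini d') ->
   connect (dlink (unlink S d')) x (fini d').
  by apply/connect_dlinkS/setSD/setSD/unlink_sub.
move=> nd'; apply: IH.
  move: xy; rewrite (connect_unlink cS dS) => /or3P[//|/andP[xd dy]|/andP[xd dy]].
    by case/negP: ndS'; apply: sep.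
  by case/negP: nd'; apply: sep; rewrite ?cS ?unlink_inv ?fter_inv.
move=> d' /(subsetP (unlink_sub _ _)) d'S xd dy; apply: sep => //.
  exact: sd.
by move: dy; apply/connect_dlinkS/setSD/setSD/unlink_sub.
Qed.

End DartSets.

(** * Sides and hulls in a tree *)

Lemma connect_restrict (V : finType) (r : rel V) (A : pred V) x y :
  (forall u v, r u v -> A u -> A v) -> A x -> connect r x y ->
  connect (fun u v => [&& r u v, A u & A v]) x y.
Proof.
move=> rA Ax /connectP[p + ->]; elim: p x Ax => [|z p IHp] x Ax /=.
  by rewrite connect0.
case/andP=> xz /(IHp _ (rA _ _ xz Ax)); apply: connect_trans.
by apply: connect1; rewrite xz Ax (rA _ _ xz Ax).
Qed.

Section Tree.
Variable T : fin_graph.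
Hypothesis T_tree : is_tree T.
Implicit Types (d e : fdart T) (x y t : fvert T) (L S : {set fvert T}).

Lemma tree_connect x y : connect (dlink [set: fdart T]) x y.
Proof.
case: T_tree => -[_ /(_ x y)[p]] + _; elim: p x => [|e p IHp] x /=.
  by move=> ->.
case=> <- /IHp; apply: connect_trans.
by have := dlink_dart (in_setT e) => /connect1.
Qed.

Lemma reducedb_reduced (p : seq (fdart T)) : reducedb p -> reduced (G := T) p.
Proof.
move=> rp p1 e p2 def_p; move: rp; rewrite def_p /reducedb sorted_cat_cons /=.
by rewrite eqxx /= andbF.
Qed.

Lemma dlink_path_walk (S : {set fdart T}) x p : path (dlink S) x p ->
  exists q, [/\ walk (G := T) x q (last x p), map (@fter T) q = p & all (mem S) q].
Proof.
elim: p x => [|z p IHp] x /=; first by exists [::].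
case/andP=> /dlinkP[e [eS ix tz]] /IHp[q [wq mq aq]].
exists (e :: q); split; rewrite /= ?mq ?tz ?eS //.
by split=> //; subst z.
Qed.

Lemma uniq_walk_reduced x q y : walk (G := T) x q y ->
  uniq (x :: map (@fter T) q) -> reducedb q.
Proof.
rewrite /reducedb; elim: q x => [//|e [//|f q] IHq] x [/= <- wq] /andP[nx un] /=.
have /= -> := IHq (fter e) wq un; rewrite andbT; apply: contra nx => /eqP->.
by rewrite fter_inv !inE eqxx orbT.
Qed.

(** A path without repeated vertices that joins the ends of [d] and avoids [d]
    closes up with [d] to a circuit. *)
Lemma tree_bridge d :
  ~~ connect (dlink (unlink [set: fdart T] d)) (fini d) (fter d).
Proof.
apply/negP; rewrite dlink_connect_sym; last exact/unlink_closed/inv_closedT.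
case/connectP=> p0 /shortenP[p pth un _] def_d {p0}.
have [q [wq mq aq]] := dlink_path_walk pth.
have nd f : f \in q -> f != finv d /\ f != d.
  by move/(allP aq); rewrite /= in_unlink => /and3P[].
case: T_tree => _ /(_ (d :: q)); apply; split=> //.
  by exists (fini d) => /=; split=> //; rewrite def_d.
apply: reducedb_reduced.
have rq := uniq_walk_reduced wq; rewrite mq in rq; move/(_ un) in rq.
have pq : path (fun e f => f != finv e) d q.
  case: q rq nd {wq mq aq} => //= f q -> /(_ f (mem_head _ _))[-> _] //.
rewrite /reducedb /= cat_path pq /= pq andbT.
have [->|] := eqVneq (last d q) d; first by rewrite eq_sym finv_neqb.
have := mem_last d q; rewrite inE => /orP[/eqP->|/nd[lq _] _].
  by rewrite eqxx.
by rewrite eq_sym finv_eq.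
Qed.

(** Locked so that rewriting with [side_inv] does not compare the two sides of a
    dart by unfolding them. *)
Definition side d :=
  locked [set t | connect (dlink (unlink setT d)) (fini d) t].

Lemma in_side d t : (t \in side d) = connect (dlink (unlink setT d)) (fini d) t.
Proof. by rewrite /side -lock inE. Qed.

Lemma side_ini d : fini d \in side d.
Proof. by rewrite in_side connect0. Qed.

Lemma side_ter d : fter d \notin side d.
Proof. by rewrite in_side tree_bridge. Qed.

Let unlink_sym d := dlink_connect_sym (unlink_closed d (@inv_closedT T)).

Lemma side_connect d x y :
  x \in side d -> (y \in side d) = connect (dlink (unlink setT d)) x y.
Proof. by rewrite !in_side => xd; rewrite (same_connect (unlink_sym d) xd). Qed.

Lemma side_inv d x : (x \in side (finv d)) = (x \notin side d).
Proof.
have := tree_connect (fini d) x.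
rewrite (connect_unlink (@inv_closedT T) (in_setT d)) !in_side unlink_inv.
rewrite -[fini (finv d)]/(fter d).
rewrite connect0 (negPf (tree_bridge d)) /= orbF.
have [xd _|//] := boolP (connect _ (fini d) x).
apply: contraNF (tree_bridge d) => dx.
by apply: connect_trans xd _; rewrite unlink_sym.
Qed.

Lemma side_dart d e : e != d -> e != finv d ->
  (fini e \in side d) = (fter e \in side d).
Proof.
move=> ed ed'; have: e \in unlink setT d by rewrite in_unlink ed ed' inE.
move/dlink_dart/connect1=> cd; rewrite !in_side.
by rewrite [LHS]unlink_sym [RHS]unlink_sym (same_connect (unlink_sym d) cd).
Qed.

Lemma conn_side d : conn_set (side d).
Proof.
apply/forall_inP=> x xd; apply/forall_inP=> y yd.
rewrite (side_connect y xd) in yd.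
have := connect_restrict (A := mem (side d)) _ xd yd.
have cl u v : dlink (unlink setT d) u v -> u \in side d -> v \in side d.
  by move=> uv ud; rewrite (side_connect v ud) connect1.
move=> /(_ cl); apply: connect_sub => u v /and3P[/dlinkP[e [_ ue ve]] ud vd].
apply: connect1; rewrite [u \in _]ud [v \in _]vd !andbT.
by apply/existsP; exists e; rewrite ue ve !eqxx.
Qed.

(** The only passage from one side of [d] to the other is [d] itself. *)
Lemma conn_cross S d x y : conn_set S -> x \in S -> y \in S ->
  x \in side d -> y \notin side d -> (fini d \in S) && (fter d \in S).
Proof.
move=> /forall_inP cS xS yS xd; apply: contraR => nd.
have /forall_inP/(_ y yS)/connectP[p + ->] := cS x xS.
elim: p x xd {xS} => //= z p IHp x xd /andP[/and3P[/existsP[e]]].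
case/andP=> /eqP ix /eqP tz xS zS; apply: IHp.
rewrite -tz -side_dart ?ix //; apply: contra nd => /eqP def_e.
  by rewrite -def_e ix tz xS zS.
by move: xS zS; rewrite -ix -tz def_e fter_inv => -> ->.
Qed.

Lemma hull_side L d t :
  t \in hull L -> t \in side d -> exists2 l, l \in L & l \in side d.
Proof.
move=> tL td; apply/exists_inP; apply: contraLR tL => /exists_inPn nL.
rewrite /hull; apply/negP=> /bigcapP/(_ (side (finv d))).
rewrite conn_side side_inv td /= => /implyP; rewrite implybF => /negP; apply.
by apply/subsetP=> l /nL; rewrite side_inv.
Qed.

(** A connected set that meets both sides of [d] contains [d], while a set of
    vertices on one side of [d] is contained in the connected set [side d] or
    [side (finv d)]. *)
Lemma hull_ends L d : (fini d \in hull L) && (fter d \in hull L) =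
  [exists l in L, l \in side d] && [exists l in L, l \notin side d].
Proof.
apply/andP/andP=> [[iL tL]|[/exists_inP[x xL xd] /exists_inP[y yL yd]]].
  have [x xL xd] := hull_side iL (side_ini d).
  have [|y yL] := hull_side (d := finv d) tL; first by rewrite side_inv side_ter.
  by rewrite side_inv => yd; split; apply/exists_inP; [exists x|exists y].
have cr S : conn_set S && (L \subset S) -> (fini d \in S) && (fter d \in S).
  by case/andP=> cS /subsetP LS; apply: conn_cross xd yd; rewrite ?LS.
by split; apply/bigcapP=> S /cr/andP[].
Qed.

(** In particular hulls are connected, and the connection stays on one side of
    every dart that does not separate [x] from [y].  Indeed [x] and [y] are joined
    by the darts that separate them, and each connected set containing [x] and [y]
    contains the ends of these darts. *)
Lemma hull_connect L x y : x \in hull L -> y \in hull L ->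
  connect (dlink [set d | [&& fini d \in hull L, fter d \in hull L
                            & (x \in side d) != (y \in side d)]]) x y.
Proof.
move=> /bigcapP xL /bigcapP yL.
apply: (connect_separating (@inv_closedT T) (tree_connect x y)) => //.
  move=> d; rewrite !inE fter_inv (side_inv d x) (side_inv d y) andbCA.
  rewrite -[fini (finv d)]/(fter d).
  by case: (x \in side d); case: (y \in side d).
move=> d _ xd dy; have x_d : x \in side d by rewrite in_side unlink_sym.
have y_d : y \notin side d by rewrite -side_inv in_side unlink_inv.
rewrite inE x_d (negPf y_d) andbT.
have cr S : conn_set S && (L \subset S) -> (fini d \in S) && (fter d \in S).
  by move=> LS; apply: conn_cross x_d y_d; [case/andP: LS|exact: xL|exact: yL].
by apply/andP; split; apply/bigcapP=> S /cr/andP[].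
Qed.

(** All edges of a tree are bridges and there is a single component. *)
Lemma card_tree : #|fvert T|.*2 = #|fdart T| + 2.
Proof.
rewrite (comps_forest (@inv_closedT T)) => [|d _]; last exact: tree_bridge.
rewrite cardsT /comps (@n_comp_image _ _ _ (fun=> tt)); last first.
- by move=> x y; rewrite tree_connect.
- exact/dlink_connect_sym/inv_closedT.
suff -> : #|(fun=> tt) @: [set: fvert T]| = 1 by rewrite addnC.
apply/eqP; rewrite eqn_leq; apply/andP; split.
  by apply: leq_trans (max_card _) _; rewrite card_unit.
case: T_tree => -[[v] _] _; apply/card_gt0P; exists tt.
by apply/imsetP; exists v.
Qed.

(** Among the darts [e] whose terminal vertex and everything behind it lie in
    [side d], one with the least number of vertices behind it ends in a leaf:
    a further dart leaving this vertex would have fewer vertices behind it. *)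
Lemma side_leaf d : exists2 t, t \in side d & degree t == 1.
Proof.
have Pd : side (finv (finv d)) \subset side d by rewrite finvK.
case: (arg_minnP (P := fun e => side (finv e) \subset side d)
  (fun e => #|side (finv e)|) Pd) => e ed min_e.
have te : fter e \in side d by apply: (subsetP ed); exact: (side_ini (finv e)).
exists (fter e) => //; apply: contraT => deg.
have /exists_inP[e' /eqP ie' ne'] :
    [exists (e' | fini e' == fter e), e' != finv e].
  move: deg; rewrite /degree (cardD1 (finv e)) !inE eqxx add1n.
  rewrite eqSS => /pred0Pn[e' /andP[/= e'e /eqP e't]].
  by apply/exists_inP; exists e'; rewrite ?e't.
have sub : side (finv e') \subset side (finv e).
  apply/subsetP=> t te'.
  have nS u v : dlink (unlink setT (finv e')) u v ->
      u \in side (finv e') -> v \in side (finv e').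
    by move=> uv ud; rewrite (side_connect v ud) connect1.
  have := connect_restrict (A := mem (side (finv e'))) nS (side_ini _).
  move: (te'); rewrite (side_connect t (side_ini _)) => ct /(_ _ ct) ct'.
  have ne : e' \in unlink setT (finv e).
    rewrite in_unlink ne' finvK in_setT !andbT.
    apply/eqP=> def; have := side_ter (finv e); rewrite fter_inv.
    by rewrite -[fini e](congr1 (@fini T) def) ie' (side_ini (finv e)).
  rewrite in_side; apply: (@connect_trans _ _ (fter e')).
    by apply/connect1/dlinkP; exists e'; rewrite ie'.
  apply: connect_sub ct' => u v /and3P[/dlinkP[f [_ fu fv]] ue ve].
  apply/connect1/dlinkP; exists f; split=> //; rewrite in_unlink inE andbT finvK.
  have nt : fter e \notin side (finv e') by rewrite side_inv -ie' side_ini.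
  by apply/andP; split; apply/negP=> /eqP def_f; case/negP: nt;
    [rewrite -def_f fv|rewrite -[fter e]/(fini (finv e)) -def_f fu].
have : #|side (finv e')| < #|side (finv e)|.
  apply/proper_card/properP; split=> //; exists (fter e).
    exact: (side_ini (finv e)).
  by rewrite side_inv -ie' side_ini.
by rewrite ltnNge min_e // (subset_trans sub ed).
Qed.

End Tree.

(** * The double star that realizes a partition of the star *)

Section CircuitCycle.
Variable G : fin_graph.

(** The consecutive pairs of darts in a reduced path. *)
Definition turn : rel (fdart G) :=
  fun e f => (fini f == fter e) && (f != finv e).

Lemma reduced_catl (p q : seq (fdart G)) :
  reduced (G := G) (p ++ q) -> reduced (G := G) p.
Proof. by move=> r p1 e p2 def_p; apply: (r p1 e (p2 ++ q)); rewrite def_p -catA. Qed.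

Lemma walk_turn_path d q e : walk (G := G) (fter d) q (fini e) ->
  reduced (G := G) (d :: rcons q e) -> path turn d (rcons q e).
Proof.
elim: q d => [|f q IHq] d /= => [wq|[fd wq]] r.
  rewrite /turn -wq eqxx andbT /=; apply/eqP=> def.
  by apply: (r [::] d [::]); rewrite def.
rewrite IHq //; last first.
  by move=> p1 e' p2 def; apply: (r (d :: p1) e' p2); rewrite /= def.
rewrite /turn andbT; apply/andP; split; first exact/eqP.
by apply/eqP=> def; apply: (r [::] d (rcons q e)); rewrite def.
Qed.

(** Cyclic reducedness makes the last and the first dart of a circuit consecutive
    too. *)
Lemma circuit_cycle (p : seq (fdart G)) : circuit (G := G) p -> cycle turn p.
Proof.
case: p => [[]//|d q] [_ [v [/= dv wq]]] rp.
apply: walk_turn_path; first by rewrite [fini d]dv.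
by apply: (@reduced_catl _ q); rewrite /= cat_rcons.
Qed.

End CircuitCycle.

Section DoubleStar.
Variables (U : fin_graph) (v0 : fvert U) (A B : {set fdart U}).
Hypotheses (A0 : A != set0) (B0 : B != set0) (AB : [disjoint A & B]).
Hypothesis ABstar : A :|: B = star v0.

Notation ray := {e | e \in star v0}.
Notation dsvert := (bool + ray)%type.
Notation dsdart := (bool * option ray)%type.

(** A dart is an orientation together with an edge: [None] is the central edge,
    which joins the centers [inl true] and [inl false], and [Some d] is the ray of
    [d], which [true] orients away from the leaf [inr d]. *)
Definition ds_inv (e : dsdart) : dsdart := (~~ e.1, e.2).
Definition ds_ini (e : dsdart) : dsvert :=
  match e with
  | (b, None) => inl b
  | (true, Some d) => inr d
  | (false, Some d) => inl (val d \in A)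
  end.

Lemma ds_invK e : ds_inv (ds_inv e) = e.
Proof. by case: e => b o; rewrite /ds_inv /= negbK. Qed.

Lemma ds_inv_neq e : ds_inv e <> e.
Proof. by case: e => -[] o []. Qed.

Definition double_star := FinGraph ds_ini ds_invK ds_inv_neq.

(** In a circuit every dart is preceded and followed by a dart other than its
    inverse.  This excludes the rays, as their leaves have degree 1, and then the
    central edge, which can only be followed by itself backwards. *)
Lemma double_star_tree : is_tree double_star.
Proof.
split.
  have cS : connect_sym (dlink [set: fdart double_star]).
    exact/dlink_connect_sym/inv_closedT.
  have stp (e : fdart double_star) :
      connect (dlink setT) (fini e) (fter e) by apply/connect1/dlink_dart.
  have ct (u : fvert double_star) : connect (dlink setT) u (inl true).
    have cb b : connect (dlink [set: fdart double_star]) (inl b) (inl true).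
      by case: b => //; exact: (stp (false, None)).
    case: u => [b //|d]; exact: connect_trans (stp (true, Some d)) (cb _).
  split=> [|u v]; first exact: (inhabits (inl true : fvert double_star)).
  have /connectP[p pth ->] : connect (dlink [set: fdart double_star]) u v.
    by rewrite (same_connect cS (ct u)) cS.
  by have [q [wq _ _]] := dlink_path_walk pth; exists q.
move=> p circ; have [] := circ; have := circuit_cycle circ.
case: p {circ} => // e p cyc _ _ _.
have {cyc} [nx vpos] : (forall e', e' \in e :: p -> exists2 f, f \in e :: p & turn e' f) /\
   (forall e', e' \in e :: p -> exists2 f, f \in e :: p & turn f e').
  split=> e' pe'; first by exists (next (e :: p) e'); [rewrite mem_next|exact: next_cycle].
  by exists (prev (e :: p) e'); [rewrite mem_prev|exact: prev_cycle].
have cen e' : e' \in e :: p -> e'.2 = None.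
  case: e' => b [d|//] /[dup] /nx[[b1 o1] _ /andP[/eqP]] + + /vpos[[b2 o2] _ /andP[/eqP]].
  rewrite /fter /=; case: b.
    move=> _ _ + /eqP; rewrite /fter /= /ds_inv /=; case: b2 o2 => -[d'|] //=.
    by move=> [<-].
  by move=> + /eqP; case: b1 o1 => -[d'|] //= [->].
have [[b o] pf /andP[/eqP]] := nx _ (mem_head e p).
move: (cen _ pf) (cen _ (mem_head e p)) => /= ->; case: (e) => b' o' /= ->.
by rewrite /fter /=; case: b {pf}; case: b' => //= _ /eqP.
Qed.

Definition ds_leaf (e : fdart U) : dsvert :=
  if insub e is Some d then inr d else inl true.

Lemma ds_leafE d (ds : d \in star v0) : ds_leaf d = inr (exist _ d ds).
Proof. by rewrite /ds_leaf insubT. Qed.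

Lemma ds_leaf_inj : {in star v0 &, injective ds_leaf}.
Proof. by move=> d d' ds ds'; rewrite !ds_leafE => -[]. Qed.

Lemma ds_leafP (t : fvert double_star) :
  (degree t == 1) = (t \in [set ds_leaf e | e in star v0]).
Proof.
case: t => [b|[d ds]]; last first.
  rewrite -ds_leafE imset_f // ds_leafE /degree.
  rewrite (eq_card (B := pred1 ((true, Some (exist _ d ds)) : dsdart))).
    by rewrite card1.
  move=> [[] [d'|]]; rewrite !inE //=.
transitivity false; last first.
  by apply/esym/negbTE/imsetP=> -[e es]; rewrite ds_leafE.
have [d dA] : exists d : ray, (val d \in A) = b.
  case: b.
    case/set0Pn: A0 => d dA.
    have ds : d \in star v0 by rewrite -ABstar inE dA.
    by exists (exist _ d ds).
  case/set0Pn: B0 => d dB.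
  have ds : d \in star v0 by rewrite -ABstar inE dB orbT.
  by exists (exist _ d ds); apply: (disjointFl AB).
rewrite /degree (cardD1 ((b, None) : dsdart)) (cardD1 ((false, Some d) : dsdart)).
by rewrite !inE /= dA if_same !eqxx xpair_eqE andbF.
Qed.

(** The central edge of the double star, with the rays of [A] at one center and
    those of [B] at the other one, has [A] and [B] on its two sides. *)
Lemma double_star_exists :
  exists (T : deformation_tree v0) (e : fdart T),
    forall d, d \in star v0 -> (d \in A) = (leaf T d \in side e).
Proof.
exists (DeformationTree double_star_tree ds_leaf_inj ds_leafP).
exists ((true, None) : dsdart) => d ds; apply/esym; rewrite [leaf _ d](ds_leafE ds).
set r := exist _ d ds.
have -> := @side_dart double_star (true, None) (true, Some r) isT isT.
have -> : @fter double_star (true, Some r) = inl (d \in A) by [].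
case: (d \in A).
  exact: (@side_ini double_star (true, None)).
by apply/negbTE; exact: (@side_ter _ double_star_tree (true, None)).
Qed.

End DoubleStar.

(** * One leg of the deformed pushout *)

Section Leg.
Variables (U : fin_graph) (v0 : fvert U) (T : deformation_tree v0).

(** The image in the deformed graph of [U]: a vertex other than [v0], or a vertex
    of [T]. *)
Definition leg_vpos (Q : fin_graph) (q : hom Q U) (z : fvert (deform T q)) :
    fvert U + fvert T :=
  match val (z : splice_vert q (local_tree T q)) with
  | inl u => inl (q u : fvert U)
  | inr (_, t) => inr t
  end.

Definition leg_dpos (Q : fin_graph) (q : hom Q U) (z : fdart (deform T q)) :
    fdart U + fdart T :=
  match val (z : splice_dart q (local_tree T q)) with
  | inl e => inl (hd q e)
  | inr (_, e) => inr e
  end.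

(** Contracting [T] to [v0]. *)
Definition pos_vert (c : fvert U + fvert T) : fvert U :=
  if c is inl u then u else v0.

Definition leg_base (Q : fin_graph) (q : hom Q U) (z : fvert (deform T q)) :
    fvert Q :=
  match val (z : splice_vert q (local_tree T q)) with
  | inl u => u
  | inr (u, _) => u
  end.

Lemma leg_base_pos (Q : fin_graph) (q : hom Q U) (z : fvert (deform T q)) :
  q (leg_base z) = pos_vert (leg_vpos z).
Proof. by case: z => -[u|[u t]] zP //=; case/andP: (zP) => /eqP. Qed.

Lemma local_starP (Q : fin_graph) (q : hom Q U) (u : fvert Q) e :
  q u = v0 -> reflect (exists2 d, fter d = u & hd q d = e) (e \in local_star v0 q u).
Proof.
move=> qu; rewrite inE; apply: (iffP andP) => [[_ /existsP[d /andP[/eqP du /eqP de]]]|].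
  by exists d.
case=> d du de; split; last by apply/existsP; exists d; rewrite du de !eqxx.
rewrite inE -de; apply/eqP; rewrite -qu -du; exact: (@hom_ter Q U q d).
Qed.

Lemma leaf_local_tree (Q : fin_graph) (q : hom Q U) (u : fvert Q) e :
  e \in local_star v0 q u -> leaf T e \in local_tree T q u.
Proof. by move=> eu; apply/(subsetP (sub_hull _))/imset_f. Qed.

(** The copy of the vertex [t] of [T] at the vertex [u] over [v0]. *)
Definition leg_vert (Q : fin_graph) (q : hom Q U) (u : fvert Q) t
    (qu : is_v0_vertex v0 q u) (tu : t \in local_tree T q u) :
    fvert (deform T q) :=
  exist (splice_vert_pred q (local_tree T q)) (inr (u, t)) (introT andP (conj qu tu)).

(** At a vertex over [v0] the local tree contains the leaf of any dart that ends
    there, so it is not empty. *)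
Lemma leg_base_onto (Q : fin_graph) (q : hom Q U) :
  (forall u : fvert Q, exists d : fdart Q, fter d = u) ->
  forall u, exists z : fvert (deform T q), leg_base z = u.
Proof.
move=> Qd u; have [qu|qu] := boolP (is_v0_vertex v0 q u); last first.
  by exists (exist (splice_vert_pred q (local_tree T q)) (inl u) qu).
have [d du] := Qd u.
have /leaf_local_tree tu : hd q d \in local_star v0 q u.
  by apply/(local_starP _ (eqP qu)); exists d.
by exists (leg_vert qu tu).
Qed.

Lemma local_tree_ends (Q : fin_graph) (q : hom Q U) (u : fvert Q) (e : fdart T) :
  (fini e \in local_tree T q u) && (fter e \in local_tree T q u) =
  [exists d in local_star v0 q u, leaf T d \in side e] &&
  [exists d in local_star v0 q u, leaf T d \notin side e].
Proof.
rewrite hull_ends; last exact: tree_is_tree.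
by congr andb; apply/exists_inP/exists_inP=> [[_ /imsetP[d du ->]]|[d du]] td;
  [exists d|exists (leaf T d); rewrite ?imset_f|exists d|exists (leaf T d); rewrite ?imset_f].
Qed.

Definition same_side (e : fdart T) (t : fvert T) :=
  [set d in star v0 | (leaf T d \in side e) == (t \in side e)].

(** The hull of leaves on the other side of [e] does not contain [t]. *)
Lemma same_side_nonempty (Q : fin_graph) (q : hom Q U) (u : fvert Q) e t :
  t \in local_tree T q u -> exists2 d, d \in local_star v0 q u & d \in same_side e t.
Proof.
move=> tu; have Ttree := tree_is_tree T.
have st d : d \in local_star v0 q u -> d \in star v0 by rewrite inE => /andP[].
have [te|te] := boolP (t \in side e).
  have [_ /imsetP[d du ->] de] := hull_side Ttree tu te.
  by exists d => //; rewrite in_set de te eqxx andbT st.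
have te' : t \in side (finv e) by rewrite side_inv.
have [_ /imsetP[d du ->]] := hull_side Ttree tu te'; rewrite side_inv // => de.
by exists d => //; rewrite in_set (negPf de) (negPf te) eqxx andbT st.
Qed.

Variables (P : fin_graph).
Variables (vpos : fvert P -> fvert U + fvert T) (dpos : fdart P -> fdart U + fdart T).

Definition tree_darts : {set fdart P} :=
  [set d | if dpos d is inr _ then true else false].

Definition between (t t' : fvert T) : {set fdart P} :=
  [set d | if dpos d is inr e then (t \in side e) != (t' \in side e) else false].

Definition avoiding (e : fdart T) : {set fdart P} :=
  [set d | if dpos d is inr e' then (e' != e) && (e' != finv e) else false].

Lemma between_tree t t' : between t t' \subset tree_darts.
Proof. by apply/subsetP=> d; rewrite !in_set; case: (dpos d). Qed.

Lemma between_avoiding e t t' : (t \in side e) = (t' \in side e) ->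
  between t t' \subset avoiding e.
Proof.
move=> tt'; apply/subsetP=> d; rewrite !in_set; case: (dpos d) => // e'.
move=> sep; apply/andP; split; apply: contraNneq sep => ->.
  by rewrite tt'.
by rewrite !(side_inv (tree_is_tree T) e) tt'.
Qed.

Variables (Q : fin_graph) (q : hom Q U) (j : hom (deform T q) P).
Hypothesis dpos_j : forall z, dpos (hd j z) = leg_dpos z.

(** The copy at [u] of the darts given by [hull_connect]. *)
Lemma leg_connect (u : fvert Q) t t' (z z' : splice_vert q (local_tree T q)) :
  val z = inr (u, t) -> val z' = inr (u, t') ->
  connect (dlink (between t t')) (j z : fvert P) (j z').
Proof.
move=> zt zt'.
have [qu tu] : is_v0_vertex v0 q u /\ t \in local_tree T q u.
  by apply/andP; have := valP z; rewrite zt.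
have tu' : t' \in local_tree T q u.
  by have := valP z'; rewrite zt' => /andP[].
have /connectP[p] := hull_connect (tree_is_tree T) tu tu'.
set S := between t t'; set r := dlink _ => pth def_t'.
have sepS d : (t \in side d) != (t' \in side d) -> forall e,
  dpos e = inr d -> e \in S by move=> sep e def_e; rewrite in_set def_e.
move: zt'; rewrite def_t'; move: (t) z zt pth {tu tu' def_t'} => t1 z.
elim: p t1 z => [|t2 p IHp] t1 z zt /=.
  by move=> _ zt'; rewrite (val_inj (etrans zt (esym zt'))) connect0.
case/andP=> /dlinkP[d []]; rewrite in_set => /and3P[d1u d2u sep] d1 d2 pth zt'.
have ds : splice_dart_pred q (local_tree T q) (inr (u, d)) by apply/and3P.
pose s : fdart (deform T q) := exist (splice_dart_pred q (local_tree T q)) _ ds.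
rewrite d2 in d2u.
apply: connect_trans (IHp t2 (leg_vert qu d2u) (erefl _) pth zt').
apply/connect1/dlinkP; exists (hd j s); split.
- exact/(sepS _ sep)/(dpos_j s).
- rewrite [LHS](hom_ini j s); congr (hv j _).
  by apply: val_inj; rewrite zt /= d1.
rewrite [LHS](hom_ter j s); congr (hv j _).
by apply: val_inj; rewrite /= -d2.
Qed.

Lemma leg_base_connect (z z' : fvert (deform T q)) :
  leg_base z = leg_base z' ->
  connect (dlink tree_darts) (j z : fvert P) (j z').
Proof.
case: z z' => [[u|[u t]] zP] [[u'|[u' t']] zP'] def_u; rewrite /leg_base /= in def_u.
- subst u'; rewrite (bool_irrelevance zP zP') connect0 //.
- by exfalso; move/andP: (zP') => [+ _]; rewrite -def_u; apply/negP.
- by exfalso; move/andP: (zP) => [+ _]; rewrite def_u; apply/negP.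
apply: (connect_dlinkS (between_tree t t')); apply: (leg_connect (u := u)) => //=.
by rewrite def_u.
Qed.

End Leg.

(** * The deformed pushout *)

Section DeformedPushout.
Variables (U W X Y : fin_graph) (a : hom W X) (b : hom W Y).
Variables (f : hom X U) (g : hom Y U).
Hypothesis sq : hom_eq (hom_comp f a) (hom_comp g b).

Definition sum_hv (n : fvert X + fvert Y) : fvert U :=
  match n with inl x => f x | inr y => g y end.

Hypothesis vert_glued : forall n n', sum_hv n = sum_hv n' ->
  glued_class (a : fvert W -> fvert X) (b : fvert W -> fvert Y) n = glued_class _ _ n'.
Hypothesis vert_onto : forall u, exists n, sum_hv n = u.
Hypothesis dart_glued : forall e e', sum_hd f g e = sum_hd f g e' ->
  glued_class (hd a : fdart W -> fdart X) (hd b : fdart W -> fdart Y) e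
  = glued_class _ _ e'.
Hypothesis dart_onto : forall d, exists e, sum_hd f g e = d.
Hypothesis X_dart : forall x : fvert X, exists d : fdart X, fter d = x.
Hypothesis Y_dart : forall y : fvert Y, exists d : fdart Y, fter d = y.
Hypothesis W_dart : forall w : fvert W, exists d : fdart W, fter d = w.

Variables (v0 : fvert U) (T : deformation_tree v0).

Notation PT := (pushout (deform_square T sq)).
Notation jX := (po_inl (deform_square T sq)).
Notation jY := (po_inr (deform_square T sq)).
Notation aT := (deform_a T a f).
Notation bT := (deform_b T sq).

(** The natural map from the deformed pushout to the deformed graph of [U],
    computed on the representative that constitutes a glued class. *)
Definition vpos (v : fvert PT) : fvert U + fvert T :=
  match val v with inl z => leg_vpos z | inr z => leg_vpos z end.

Definition dpos (d : fdart PT) : fdart U + fdart T :=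
  match val d with inl z => leg_dpos z | inr z => leg_dpos z end.

Lemma po_vert_glue w : jX (aT w) = jY (bT w).
Proof. exact: (@glued_eqP _ _ _ (aT : fvert (deform T _) -> fvert (deform T _))). Qed.

Lemma po_dart_glue w : hd jX (hd aT w) = hd jY (hd bT w).
Proof. exact: (@glued_eqP _ _ _ (hd aT : fdart (deform T _) -> fdart (deform T _))). Qed.

Lemma sum_vpos_glue (c : fvert (deform T (hom_comp f a))) :
  leg_vpos (aT c : fvert (deform T f)) = leg_vpos (bT c : fvert (deform T g)).
Proof. by case: c => -[u|[u t]] zP //=; congr inl; exact: (sq.1 u). Qed.

Lemma sum_dpos_glue (c : fdart (deform T (hom_comp f a))) :
  leg_dpos (hd aT c : fdart (deform T f)) = leg_dpos (hd bT c : fdart (deform T g)).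
Proof. by case: c => -[u|[u t]] zP //=; congr inl; exact: (sq.2 u). Qed.

Definition sum_vpos (n : fvert (deform T f) + fvert (deform T g)) :=
  match n with inl z => leg_vpos z | inr z => leg_vpos z end.
Definition sum_dpos (n : fdart (deform T f) + fdart (deform T g)) :=
  match n with inl z => leg_dpos z | inr z => leg_dpos z end.

Lemma vpos_inl z : vpos (jX z) = leg_vpos z.
Proof. exact: (glued_compat (h := sum_vpos) sum_vpos_glue (inl z)). Qed.

Lemma vpos_inr z : vpos (jY z) = leg_vpos z.
Proof. exact: (glued_compat (h := sum_vpos) sum_vpos_glue (inr z)). Qed.

Lemma dpos_inl z : dpos (hd jX z) = leg_dpos z.
Proof. exact: (glued_compat (h := sum_dpos) sum_dpos_glue (inl z)). Qed.

Lemma dpos_inr z : dpos (hd jY z) = leg_dpos z.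
Proof. exact: (glued_compat (h := sum_dpos) sum_dpos_glue (inr z)). Qed.

Lemma po_vertP (v : fvert PT) :
  (exists z : fvert (deform T f), v = jX z) \/ (exists z : fvert (deform T g), v = jY z).
Proof. by rewrite -(glued_classK v); case: (val v) => z; [left|right]; exists z. Qed.

Lemma po_dartP (d : fdart PT) :
  (exists z : fdart (deform T f), d = hd jX z) \/ (exists z : fdart (deform T g), d = hd jY z).
Proof. by rewrite -(glued_classK d); case: (val d) => z; [left|right]; exists z. Qed.

Lemma dpos_finv d :
  dpos (finv d) = match dpos d with inl e => inl (finv e) | inr e => inr (finv e) end.
Proof.
case: (po_dartP d) => -[z ->]; rewrite ?dpos_inl ?dpos_inr.
  rewrite -[finv _](hom_inv jX z) dpos_inl; case: z => -[e|[u e]] zP //=.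
  by congr inl; exact: (@hom_inv X U f e).
rewrite -[finv _](hom_inv jY z) dpos_inr; case: z => -[e|[u e]] zP //=.
by congr inl; exact: (@hom_inv Y U g e).
Qed.

Lemma vpos_fini d : vpos (fini d) =
  match dpos d with
  | inl e => if fini e == v0 then inr (leaf T (finv e)) else inl (fini e)
  | inr e => inr (fini e)
  end.
Proof.
case: (po_dartP d) => -[z ->]; rewrite ?dpos_inl ?dpos_inr.
  rewrite [fini _](hom_ini jX z) vpos_inl; case: z => -[e|[u e]] zP //=.
  rewrite /leg_vpos /leg_dpos /= [fini (hd f e)](@hom_ini X U f e) -/(is_v0_vertex v0 f (fini e)).
  by case: ifP => // _; congr (inr (leaf T _)); exact: (@hom_inv X U f e).
rewrite [fini _](hom_ini jY z) vpos_inr; case: z => -[e|[u e]] zP //=.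
rewrite /leg_vpos /leg_dpos /= [fini (hd g e)](@hom_ini Y U g e) -/(is_v0_vertex v0 g (fini e)).
by case: ifP => // _; congr (inr (leaf T _)); exact: (@hom_inv Y U g e).
Qed.

Lemma vpos_fter d : vpos (fter d) =
  match dpos d with
  | inl e => if fter e == v0 then inr (leaf T e) else inl (fter e)
  | inr e => inr (fter e)
  end.
Proof. by rewrite [LHS]vpos_fini dpos_finv; case: (dpos d) => e; rewrite ?finvK. Qed.

Notation F := (tree_darts dpos).

Lemma tree_darts_closed : inv_closed F.
Proof. by move=> d; rewrite !in_set dpos_finv; case: (dpos d). Qed.

Let Fsym := dlink_connect_sym tree_darts_closed.

(** The component of [F] that contains the copies over a given vertex of [X] or
    [Y].  Being a set, it is defined without a choice of a copy. *)
Definition base_class (n : fvert X + fvert Y) : {set fvert PT} :=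
  match n with
  | inl x => [set v | [exists z : fvert (deform T f),
                        (leg_base z == x) && connect (dlink F) (jX z) v]]
  | inr y => [set v | [exists z : fvert (deform T g),
                        (leg_base z == y) && connect (dlink F) (jY z) v]]
  end.

Lemma base_class_inl (z : fvert (deform T f)) v :
  (v \in base_class (inl (leg_base z))) = connect (dlink F) (jX z) v.
Proof.
rewrite in_set; apply/existsP/idP=> [[z' /andP[/eqP zz' zv]]|zv].
  by apply: connect_trans zv; apply: leg_base_connect dpos_inl _ _ _; rewrite zz'.
by exists z; rewrite eqxx.
Qed.

Lemma base_class_inr (z : fvert (deform T g)) v :
  (v \in base_class (inr (leg_base z))) = connect (dlink F) (jY z) v.
Proof.
rewrite in_set; apply/existsP/idP=> [[z' /andP[/eqP zz' zv]]|zv].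
  by apply: connect_trans zv; apply: leg_base_connect dpos_inr _ _ _; rewrite zz'.
by exists z; rewrite eqxx.
Qed.

(** The subtree at [w] is not empty, and any vertex of it is glued into both the
    subtree at [a w] and the subtree at [b w]. *)
Lemma base_class_glue (w : fvert W) :
  base_class (inl (a w : fvert X)) = base_class (inr (b w : fvert Y)).
Proof.
have [z <-] := leg_base_onto T (hom_comp f a) W_dart w; apply/setP=> v.
have -> : a (leg_base z) = leg_base (aT z : fvert (deform T f)) by case: z => -[u|[u t]].
have -> : b (leg_base z) = leg_base (bT z : fvert (deform T g)) by case: z => -[u|[u t]].
by rewrite base_class_inl base_class_inr po_vert_glue.
Qed.

Lemma base_class_eq n n' : sum_hv n = sum_hv n' -> base_class n = base_class n'.
Proof.
move/vert_glued=> nn'.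
by rewrite -(glued_compat base_class_glue n) nn' (glued_compat base_class_glue).
Qed.

Definition po_base (v : fvert PT) : fvert U := pos_vert (vpos v).

Lemma po_class (v : fvert PT) : exists2 n, sum_hv n = po_base v &
  forall v', (v' \in base_class n) = connect (dlink F) v v'.
Proof.
case: (po_vertP v) => -[z ->].
  exists (inl (leg_base z)) => [|v']; last exact: base_class_inl.
  by rewrite /po_base vpos_inl -leg_base_pos.
exists (inr (leg_base z)) => [|v']; last exact: base_class_inr.
by rewrite /po_base vpos_inr -leg_base_pos.
Qed.

(** Contracting the copies of [T] recovers the pushout of [X] and [Y], which is
    [U]: the identifications that make two vertices of [X] and [Y] equal in [U]
    lift to connections by [F], as do the copies at one vertex. *)
Lemma connect_tree_darts v v' :
  connect (dlink F) v v' = (po_base v == po_base v').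
Proof.
apply/idP/eqP=> [|vv'].
  case/connectP=> p + ->; elim: p v => //= v1 p IHp v /andP[/dlinkP[d []]].
  rewrite in_set => dF <- <- /IHp <-; rewrite /po_base vpos_fini vpos_fter.
  by case: (dpos d) dF.
have [n hn vn] := po_class v; have [n' hn' vn'] := po_class v'.
rewrite -vn (@base_class_eq n n') ?vn' ?connect0 //.
by rewrite hn hn'.
Qed.

Lemma po_base_onto u : exists v, po_base v = u.
Proof.
have [[x|y] <-] := vert_onto u.
  have [z <-] := leg_base_onto T f X_dart x; exists (jX z).
  by rewrite /po_base vpos_inl -leg_base_pos.
have [z <-] := leg_base_onto T g Y_dart y; exists (jY z).
by rewrite /po_base vpos_inr -leg_base_pos.
Qed.

Lemma comps_tree_darts : comps F = #|fvert U|.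
Proof.
rewrite /comps (n_comp_image Fsym connect_tree_darts) -cardsT.
apply: eq_card => u; rewrite in_setT; apply/imsetP.
by have [v <-] := po_base_onto u; exists v.
Qed.

(** The darts outside the copies of [T] are glued as they are before the
    deformation. *)
Definition old_dart (n : fdart X + fdart Y) : fdart PT :=
  match n with
  | inl d => hd jX (exist (splice_dart_pred f (local_tree T f)) (inl d) isT)
  | inr d => hd jY (exist (splice_dart_pred g (local_tree T g)) (inl d) isT)
  end.

Lemma old_dart_glue (w : fdart W) :
  old_dart (inl (hd a w : fdart X)) = old_dart (inr (hd b w : fdart Y)).
Proof.
rewrite /=; pose z : fdart (deform T (hom_comp f a)) :=
  exist (splice_dart_pred (hom_comp f a) (local_tree T (hom_comp f a))) (inl w) isT.
transitivity (hd jX (hd aT z)); first by congr (hd jX _); apply: val_inj.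
by rewrite po_dart_glue; congr (hd jY _); apply: val_inj.
Qed.

Lemma old_dart_eq n n' : sum_hd f g n = sum_hd f g n' -> old_dart n = old_dart n'.
Proof.
move/dart_glued=> nn'.
by rewrite -(glued_compat old_dart_glue n) nn' (glued_compat old_dart_glue).
Qed.

Lemma dpos_old_dart n : dpos (old_dart n) = inl (sum_hd f g n).
Proof. by case: n => d; rewrite ?dpos_inl ?dpos_inr. Qed.

Lemma dpos_oldP d e : dpos d = inl e -> exists2 n, sum_hd f g n = e & d = old_dart n.
Proof.
case: (po_dartP d) => -[z ->]; rewrite ?dpos_inl ?dpos_inr; case: z => -[e'|[u e']] zP //= -[<-].
  by exists (inl e') => //; congr (hd jX _); apply: val_inj.
by exists (inr e') => //; congr (hd jY _); apply: val_inj.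
Qed.

Lemma dpos_old_inj d d' e : dpos d = inl e -> dpos d' = inl e -> d = d'.
Proof. by move=> /dpos_oldP[n <- ->] /dpos_oldP[n' /esym/old_dart_eq <- ->]. Qed.

Lemma card_po_darts : #|fdart PT| = #|fdart U| + #|F|.
Proof.
rewrite -(cardsC F) addnC; congr addn.
have dpos_oldE d : d \in ~: F -> exists e, dpos d = inl e.
  by rewrite !inE; case: (dpos d) => // e _; exists e.
rewrite -(card_in_imset (f := dpos)) => [|d d' /dpos_oldE[e de] _ dd']; last first.
  exact: (dpos_old_inj de (etrans (esym dd') de)).
have inl_inj : injective (inl : fdart U -> fdart U + fdart T) by move=> e e' [].
rewrite -cardsT -(card_imset _ inl_inj); apply: eq_card => c.
apply/imsetP/imsetP=> [[d /dpos_oldE[e de] ->]|[e _ ->]]; first by exists e.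
have [n <-] := dart_onto e; exists (old_dart n); last by rewrite dpos_old_dart.
by rewrite in_setC in_set dpos_old_dart.
Qed.

(** The darts outside [F] are as many as those of [U], and both numbers of darts
    are even, so that halving them loses nothing. *)
Lemma rbar_po : rbar PT = rbar U <-> #|fvert PT|.*2 = #|fvert U|.*2 + #|F|.
Proof.
rewrite /rbar card_po_darts.
have := card_inv_closed tree_darts_closed.
have := card_inv_closed (@inv_closedT U); rewrite cardsT; lia.
Qed.


Section Cut.
Variables (e : fdart T) (A B : {set fdart U}).
Hypothesis A_side : forall d, d \in star v0 -> (d \in A) = (leaf T d \in side e).
Hypothesis B_side : forall d, d \in star v0 -> (d \in B) = (leaf T d \notin side e).

Lemma local_star_star (Q : fin_graph) (q : hom Q U) (u : fvert Q) d :
  d \in local_star v0 q u -> d \in star v0.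
Proof. by rewrite in_set => /andP[]. Qed.

(** By [hull_ends], the local tree contains [e] exactly when the local star has
    elements on both sides of [e]. *)
Lemma splice_dart_type (Q : fin_graph) (q : hom Q U) (u : fvert Q) :
  splice_dart_pred q (local_tree T q) (inr (u, e)) = of_type v0 A B q u.
Proof.
rewrite /= local_tree_ends /of_type; congr [&& _, _ & _];
  apply/exists_inP/set0Pn=> [[d du td]|[d]].
- by exists d; rewrite inE du A_side // (local_star_star du).
- by rewrite inE => /andP[du]; rewrite A_side ?(local_star_star du) //; exists d.
- by exists d; rewrite inE du B_side // (local_star_star du).
- by rewrite inE => /andP[du]; rewrite B_side ?(local_star_star du) //; exists d.
Qed.

(** The vertices of the graph Psi({A,B}), for arbitrary maps to [U]. *)
Definition type_vert : finType :=
  ({x | of_type v0 A B f x} + {y | of_type v0 A B g y})%type.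

Definition type_joined (x : fvert X) (y : fvert Y) : bool :=
  [exists w : fvert W, [&& of_type v0 A B (hom_comp f a) w,
    (a w : fvert X) == x & (b w : fvert Y) == y]].

Definition type_edge : rel type_vert := fun z1 z2 =>
  match z1, z2 with
  | inl x, inr y | inr y, inl x => type_joined (val x) (val y)
  | _, _ => false
  end.

Lemma type_edge_sym : connect_sym type_edge.
Proof. by apply: sym_connect_sym => -[x|y] [x'|y']. Qed.

(** A partial inverse of [sum_dart_of_type], defined on all darts so that it can
    be compared along the gluing. *)
Definition type_of_dart (s : fdart (deform T f) + fdart (deform T g)) :
    option type_vert :=
  match s with
  | inl z => match val (z : splice_dart f (local_tree T f)) with
             | inr (x, e') => if e' == e then omap inl (insub x) else None
             | inl _ => None
             end
  | inr z => match val (z : splice_dart g (local_tree T g)) with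
             | inr (y, e') => if e' == e then omap inr (insub y) else None
             | inl _ => None
             end
  end.

Definition sum_dart_of_type (z : type_vert) :
    fdart (deform T f) + fdart (deform T g) :=
  match z with
  | inl x => inl (exist (splice_dart_pred f (local_tree T f)) (inr (val x, e))
                    (etrans (splice_dart_type f (val x)) (valP x)))
  | inr y => inr (exist (splice_dart_pred g (local_tree T g)) (inr (val y, e))
                    (etrans (splice_dart_type g (val y)) (valP y)))
  end.

Definition dart_of_type (z : type_vert) : fdart PT :=
  match sum_dart_of_type z with inl d => hd jX d | inr d => hd jY d end.

Lemma sum_dart_of_typeK z : type_of_dart (sum_dart_of_type z) = Some z.
Proof. by case: z => z; rewrite /= eqxx valK. Qed.

Lemma type_of_dart_glue (c : fdart (deform T (hom_comp f a))) :
  omap (root type_edge) (type_of_dart (inl (hd aT c))) =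
  omap (root type_edge) (type_of_dart (inr (hd bT c))).
Proof.
case: c => -[d|[w e']] cP //=; case: eqP cP => // -> cP.
have wP : of_type v0 A B (hom_comp f a) w by rewrite -splice_dart_type.
have ty (Q : fin_graph) (q : hom Q U) (h : hom W Q) :
    hom_eq (hom_comp q h) (hom_comp f a) -> of_type v0 A B q (h w).
  move=> hq; have sub := subsetP (local_star_sub v0 hq w).
  case/and3P: wP => w0 /set0Pn[d1 /setIP[d1w d1A]] /set0Pn[d2 /setIP[d2w d2B]].
  apply/and3P; split.
  - by rewrite (over_v0 v0 hq).
  - by apply/set0Pn; exists d1; rewrite inE sub.
  - by apply/set0Pn; exists d2; rewrite inE sub.
have xP : of_type v0 A B f (a w) by apply: ty.
have yP : of_type v0 A B g (b w) by apply: ty; split=> u; [rewrite (sq.1 u)|rewrite (sq.2 u)].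
rewrite !insubT /=; congr Some; apply/(rootP type_edge_sym)/connect1.
by apply/existsP; exists w; rewrite wP !eqxx.
Qed.

(** The edges of Psi({A,B}) are the identifications between the copies of [e]. *)
Lemma connect_type_edge z z' :
  connect type_edge z z' = (dart_of_type z == dart_of_type z').
Proof.
apply/idP/eqP=> [/connectP[p + ->]|zz'].
  (* A vertex [w] of type {A,B} carries a copy of [e], which is glued into the
     copies at [x] and [y]. *)
  have joined x y : type_joined (val x) (val y) ->
      dart_of_type (inl x) = dart_of_type (inr y).
    case/existsP=> w /and3P[wP /eqP wx /eqP wy].
    pose c : fdart (deform T (hom_comp f a)) :=
      exist (splice_dart_pred (hom_comp f a) (local_tree T (hom_comp f a)))
        (inr (w, e)) (etrans (splice_dart_type (hom_comp f a) w) wP).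
    transitivity (hd jX (hd aT c)).
      by congr (hd jX _); apply: val_inj; rewrite /= -wx.
    by rewrite po_dart_glue; congr (hd jY _); apply: val_inj; rewrite /= -wy.
  elim: p z => //= z1 p IHp z /andP[zz1 /IHp <-].
  by case: z z1 zz1 => z [z1|z1] //= /joined.
pose h s := omap (root type_edge) (type_of_dart s).
have: h (sum_dart_of_type z) = h (sum_dart_of_type z').
  have hP z1 : h (val (dart_of_type z1)) = h (sum_dart_of_type z1).
    rewrite /dart_of_type; case: sum_dart_of_type => d;
      exact: (glued_compat (h := h) type_of_dart_glue).
  by rewrite -!hP zz'.
by rewrite /h !sum_dart_of_typeK /= => -[/(rootP type_edge_sym)].
Qed.

Definition darts_over (e' : fdart T) : {set fdart PT} := [set d | dpos d == inr e'].

Lemma n_comp_type_edge : n_comp type_edge predT = #|darts_over e|.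
Proof.
rewrite (n_comp_image type_edge_sym connect_type_edge); apply: eq_card => d.
rewrite [RHS]in_set; apply/imsetP/eqP=> [[z _ ->]|].
  by case: z => z; rewrite /dart_of_type /= ?dpos_inl ?dpos_inr.
case: (po_dartP d) => -[z ->]; rewrite ?dpos_inl ?dpos_inr;
  case: z => -[//|[u e']] zP [ee']; move: zP; rewrite ee' => zP.
  have uP : of_type v0 A B f u by rewrite -splice_dart_type.
  by exists (inl (exist _ u uP)) => //; congr (hd jX _); apply: val_inj.
have uP : of_type v0 A B g u by rewrite -splice_dart_type.
by exists (inr (exist _ u uP)) => //; congr (hd jY _); apply: val_inj.
Qed.


Lemma same_side_sub (Q : fin_graph) (q : hom Q U) (u : fvert Q) t :
  local_star v0 q u :&: same_side e t =
  local_star v0 q u :&: (if t \in side e then A else B).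
Proof.
apply/setP=> d; rewrite !in_setI; case du: (d \in _) => //=.
have ds := local_star_star du; rewrite in_set ds /=.
by case: ifP => te; rewrite ?A_side ?B_side //; case: (leaf T d \in _).
Qed.

Notation avoid := (avoiding dpos e).

Lemma avoid_closed : inv_closed avoid.
Proof.
move=> d; rewrite !in_set dpos_finv; case: (dpos d) => // e'.
by rewrite !finv_eq finvK andbC.
Qed.

Let avoid_sym := dlink_connect_sym avoid_closed.

Lemma avoid_darts : avoid = F :\: (darts_over e :|: darts_over (finv e)).
Proof.
apply/setP=> d; rewrite in_setD in_setU !in_set; case: (dpos d) => // e'.
by rewrite andbT -negb_or.
Qed.

Lemma card_darts_over_inv : #|darts_over (finv e)| = #|darts_over e|.
Proof.
rewrite -(card_imset _ (can_inj (@finvK PT))); apply: eq_card => d.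
rewrite [RHS]in_set; apply/imsetP/eqP=> [[d']|de].
  by rewrite in_set => /eqP de ->; rewrite dpos_finv de finvK.
by exists (finv d); rewrite ?finvK // in_set dpos_finv de.
Qed.

Lemma card_cut : #|darts_over e :|: darts_over (finv e)| = #|darts_over e|.*2.
Proof.
rewrite cardsU card_darts_over_inv addnn (_ : _ :&: _ = set0) ?cards0 ?subn0 //.
apply/setP=> d; rewrite in_setI !in_set0 !in_set; apply/negP=> /andP[/eqP-> /eqP[]].
by move/esym/finv_neq.
Qed.

Lemma cut_closed : inv_closed (darts_over e :|: darts_over (finv e)).
Proof.
move=> d; rewrite !in_setU !in_set dpos_finv; case: (dpos d) => // e'.
have inrE x y : (inr x == inr y :> fdart U + fdart T) = (x == y) by [].
by rewrite !inrE orbC finv_eq finvK finv_eq.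
Qed.

Lemma cut_sub : darts_over e :|: darts_over (finv e) \subset F.
Proof. by apply/subsetP=> d; rewrite in_setU !in_set; case: (dpos d). Qed.

Section ComponentsFromClasses.
Variables (k : nat) (C : 'I_k.+1 -> {set fdart U}).
Hypothesis C_disj : forall i i', i != i' -> [disjoint C i & C i'].
Hypothesis C_star : forall i, C i \subset star v0.
Hypothesis C_neq0 : forall i, C i != set0.
Hypothesis C_f : compatible v0 C A B f.
Hypothesis C_g : compatible v0 C A B g.

(** The label of the copy of [t] at [u]: the class that contains the part of the
    local star of [u] on the same side of [e] as [t].  It is unique because that
    part is not empty; the default value does not occur over [v0]. *)
Definition class_of (Q : fin_graph) (q : hom Q U) (u : fvert Q) t : 'I_k.+1 :=
  odflt ord0 [pick i | local_star v0 q u :&: same_side e t \subset C i].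

Lemma class_of_sub (Q : fin_graph) (q : hom Q U) (u : fvert Q) t :
  compatible v0 C A B q -> is_v0_vertex v0 q u ->
  local_star v0 q u :&: same_side e t \subset C (class_of q u t).
Proof.
move=> Cq qu; rewrite /class_of; case: pickP => //= none.
have [i Ci] : exists i, local_star v0 q u :&: same_side e t \subset C i.
  rewrite same_side_sub; have [cA cB] := Cq u qu.
  by case: ifP => _; [case: cA|case: cB] => // ->; exists ord0; rewrite sub0set.
by rewrite none in Ci.
Qed.

Lemma class_of_eq (Q : fin_graph) (q : hom Q U) (u : fvert Q) t d i :
  compatible v0 C A B q -> is_v0_vertex v0 q u ->
  d \in local_star v0 q u -> d \in same_side e t -> d \in C i -> class_of q u t = i.
Proof.
move=> Cq qu du dt di; apply: contraTeq di => /C_disj/disjointFr->//.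
by apply: (subsetP (class_of_sub t Cq qu)); rewrite inE du.
Qed.

Definition sum_class (z : fvert (deform T f) + fvert (deform T g)) :
    fvert U + 'I_k.+1 :=
  match z with
  | inl z => match val (z : splice_vert f (local_tree T f)) with
             | inl x => inl (f x : fvert U)
             | inr (x, t) => inr (class_of f x t)
             end
  | inr z => match val (z : splice_vert g (local_tree T g)) with
             | inl y => inl (g y : fvert U)
             | inr (y, t) => inr (class_of g y t)
             end
  end.

(** The local star of [w] is contained in those of [a w] and [b w], so an element
    of it on the side of [t] determines the label at all three vertices. *)
Lemma sum_class_glue (c : fvert (deform T (hom_comp f a))) :
  sum_class (inl (aT c)) = sum_class (inr (bT c)).
Proof.
case: c => -[w|[w t]] cP /=; first by congr inl; exact: (sq.1 w).
have /andP[w0 wt] := cP; congr inr.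
have [d dw dt] := same_side_nonempty e wt.
have sqb : hom_eq (hom_comp g b) (hom_comp f a).
  by split=> u; [rewrite (sq.1 u)|rewrite (sq.2 u)].
have aw0 : is_v0_vertex v0 f (a w) by rewrite (over_v0 v0 (conj (frefl _) (frefl _))).
have bw0 : is_v0_vertex v0 g (b w) by rewrite (over_v0 v0 sqb).
have daw : d \in local_star v0 f (a w).
  exact: (subsetP (local_star_sub v0 (conj (frefl _) (frefl _)) w)).
have dbw : d \in local_star v0 g (b w).
  exact: (subsetP (local_star_sub v0 sqb w)).
apply: (class_of_eq C_f aw0 daw dt).
by apply: (subsetP (class_of_sub t C_g bw0)); rewrite inE dbw.
Qed.

Definition po_class_of (v : fvert PT) := sum_class (val v).

Lemma po_class_of_inl z : po_class_of (jX z) = sum_class (inl z).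
Proof. exact: (glued_compat (h := sum_class) sum_class_glue (inl z)). Qed.

Lemma po_class_of_inr z : po_class_of (jY z) = sum_class (inr z).
Proof. exact: (glued_compat (h := sum_class) sum_class_glue (inr z)). Qed.

Lemma class_of_same_side (Q : fin_graph) (q : hom Q U) (u : fvert Q) t t' :
  same_side e t = same_side e t' -> class_of q u t = class_of q u t'.
Proof. by rewrite /class_of => ->. Qed.

Lemma same_side_dart e' : e' != e -> e' != finv e -> same_side e (fini e') = same_side e (fter e').
Proof. by move=> n1 n2; apply/setP=> d; rewrite !in_set (side_dart n1 n2). Qed.

Lemma po_class_of_dlink v v' : dlink avoid v v' -> po_class_of v = po_class_of v'.
Proof.
case/dlinkP=> d [dA <- <-]; move: dA; rewrite in_set.
case: (po_dartP d) => -[z ->]; rewrite ?dpos_inl ?dpos_inr.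
  rewrite [fini _](hom_ini jX z) [fter _](hom_ter jX z) !po_class_of_inl.
  case: z => -[//|[u e']] zP /andP[n1 n2] /=; congr inr.
  exact/class_of_same_side/same_side_dart.
rewrite [fini _](hom_ini jY z) [fter _](hom_ter jY z) !po_class_of_inr.
case: z => -[//|[u e']] zP /andP[n1 n2] /=; congr inr.
exact/class_of_same_side/same_side_dart.
Qed.

Lemma po_class_of_onto c : c != inl v0 -> exists v, po_class_of v = c.
Proof.
case: c => [u uv0|i _].
  have [v vu] := po_base_onto u; exists v; move: vu uv0; rewrite /po_base.
  case: (po_vertP v) => -[z ->]; rewrite ?vpos_inl ?vpos_inr ?po_class_of_inl ?po_class_of_inr;
    case: z => -[x|[x t]] zP /=; rewrite /leg_vpos /= => <- //; by rewrite eqxx.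
have [d di] := set0Pn _ (C_neq0 i); have ds := subsetP (C_star i) d di.
have dh : d \in same_side e (leaf T d) by rewrite in_set ds eqxx.
have [[d'|d'] def_d] := dart_onto d.
  have u0 : is_v0_vertex v0 f (fter d').
    move: ds; rewrite inE -def_d /is_v0_vertex => /eqP <-; apply/eqP/esym.
    exact: (@hom_ter X U f d').
  have du : d \in local_star v0 f (fter d').
    by apply/(local_starP _ (eqP u0)); exists d'.
  exists (jX (leg_vert u0 (leaf_local_tree T du))); rewrite po_class_of_inl /=.
  by congr inr; apply: class_of_eq di.
have u0 : is_v0_vertex v0 g (fter d').
  move: ds; rewrite inE -def_d /is_v0_vertex => /eqP <-; apply/eqP/esym.
  exact: (@hom_ter Y U g d').
have du : d \in local_star v0 g (fter d').
  by apply/(local_starP _ (eqP u0)); exists d'.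
exists (jY (leg_vert u0 (leaf_local_tree T du))); rewrite po_class_of_inr /=.
by congr inr; apply: class_of_eq di.
Qed.

(** The function [po_class_of] is constant on the components and takes all values
    except [inl v0]; there are [#|VU| - 1] vertices of [U] other than [v0] and
    [k + 1] labels. *)
Lemma leq_comps_avoid : #|fvert U| + k <= comps avoid.
Proof.
apply: leq_trans (leq_image_n_comp avoid_sym po_class_of_dlink).
have -> : #|fvert U| + k = #|[set~ (inl v0 : fvert U + 'I_k.+1)]|.
  by rewrite cardsC1 card_sum card_ord addnS.
apply/subset_leq_card/subsetP=> c; rewrite in_setC in_set1 => /po_class_of_onto[v <-].
exact: imset_f.
Qed.

End ComponentsFromClasses.


(** No dart of [F] is incident to a vertex outside the copies of [T]. *)
Lemma connect_old_vert v v' u : vpos v = inl u -> connect (dlink F) v v' -> v' = v.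
Proof.
move=> vu /connectP[[|v1 p] //= /andP[/dlinkP[d [dF dv _]]] _ _].
by move: vu dF; rewrite -dv vpos_fini in_set; case: (dpos d).
Qed.

Lemma vpos_inl_neq v u : vpos v = inl u -> u != v0.
Proof.
case: (po_vertP v) => -[z ->]; rewrite ?vpos_inl ?vpos_inr;
  by case: z => -[x|[x t]] zP //= [<-].
Qed.

Definition is_old (v : fvert PT) : bool := if vpos v is inl _ then true else false.

Lemma card_old_verts : #|[set v | is_old v]| = #|fvert U|.-1.
Proof.
rewrite -(card_in_imset (f := po_base)) => [|v v']; last first.
  rewrite !in_set /is_old; case vu: (vpos v) => [u|//] _ _ /eqP.
  by rewrite -connect_tree_darts => /(connect_old_vert vu).
rewrite -(cardsC1 v0); apply: eq_card => u; rewrite in_setC in_set1.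
apply/imsetP/idP=> [[v + ->]|uv0].
  rewrite in_set /is_old /po_base; case vu: (vpos v) => [u'|//] _.
  exact: vpos_inl_neq vu.
have [v vu] := po_base_onto u; exists v; last by [].
move: vu uv0; rewrite in_set /is_old /po_base.
by case: (vpos v) => //= t <-; rewrite eqxx.
Qed.

Notation rt := (root (dlink avoid)).

Definition new_roots : {set fvert PT} := [set v | roots (dlink avoid) v & ~~ is_old v].

Lemma avoid_sub : avoid \subset F.
Proof. by rewrite avoid_darts subsetDl. Qed.

(** The vertices outside the copies of [T] are components of their own. *)
Lemma card_new_roots : comps avoid = #|fvert U|.-1 + #|new_roots|.
Proof.
rewrite -card_old_verts /comps /n_comp_mem -[LHS](cardID is_old); congr addn;
  apply: eq_card => v; rewrite !inE ?andbT ?[v \in is_old]unfold_in //; last first.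
  by rewrite andbC.
rewrite andbC andb_idr // /is_old; case vu: (vpos v) => [u|//] _.
apply/eqP/(connect_old_vert vu)/(connect_dlinkS avoid_sub); exact: connect_root.
Qed.

Lemma connect_avoid_vpos v v' : connect (dlink avoid) v v' ->
  match vpos v, vpos v' with
  | inl _, inl _ => True
  | inr t, inr t' => (t \in side e) = (t' \in side e)
  | _, _ => False
  end.
Proof.
case/connectP=> p + ->; elim: p v => [|v1 p IHp] v /=; first by case: (vpos v).
case/andP=> /dlinkP[d [+ <- <-]] /IHp; rewrite in_set vpos_fini vpos_fter.
by case: (dpos d) => // e' /andP[n1 n2]; rewrite side_dart.
Qed.

Section ClassesFromComponents.

(** The terminal vertex of [s] is the copy of the leaf of [d] at [u], which lies on
    the same side of [e] as [t]; the connection inside the local tree does not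
    cross [e]. *)
Lemma leg_avoid (Q : fin_graph) (q : hom Q U) (j : hom (deform T q) PT)
    (dpos_j : forall z, dpos (hd j z) = leg_dpos z) (u : fvert Q) t d s
    (u0 : is_v0_vertex v0 q u) (ut : t \in local_tree T q u) :
  d \in local_star v0 q u -> d \in same_side e t -> dpos s = inl d ->
  connect (dlink avoid) (j (leg_vert u0 ut)) (fter s).
Proof.
move=> du dt sd; have /(local_starP _ (eqP u0))[d' d'u d'd] := du.
pose z : fdart (deform T q) := exist (splice_dart_pred q (local_tree T q)) (inl d') isT.
have -> : s = hd j z by apply: dpos_old_inj sd _; rewrite dpos_j /leg_dpos /= d'd.
rewrite [fter _](hom_ter j z).
have tl : (t \in side e) = (leaf T d \in side e).
  by move: dt; rewrite in_set => /andP[_ /eqP].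
apply: (connect_dlinkS (between_avoiding dpos tl)).
apply: (leg_connect dpos_j (u := u)) => //=.
by rewrite [fini _]d'u u0 finvK d'd.
Qed.

Hypothesis forest_count : #|fvert PT|.*2 = #|fvert U|.*2 + #|F|.

(** In a forest every removed edge creates a component, so both bounds of
    [comps_leq] are attained. *)
Lemma comps_avoid : comps avoid = #|fvert U| + #|darts_over e|.
Proof.
have := comps_leq (@inv_closed0 PT) avoid_closed (sub0set _).
have := comps_leq avoid_closed tree_darts_closed avoid_sub.
rewrite comps0 comps_tree_darts cards0 forest_count.
have := cardsD F (darts_over e :|: darts_over (finv e)); rewrite (setIidPr cut_sub) card_cut.
rewrite -avoid_darts; have := subset_leq_card cut_sub; rewrite card_cut; lia.
Qed.

(** The classes are indexed by the [k + 1] components over [v0] that are left when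
    the darts over [e] are removed.  An element [d] of the star of [v0] belongs to
    the component of the terminal vertex of the dart of the pushout over [d], which
    is the vertex over the leaf of [d]. *)
Lemma exists_classes k : #|darts_over e| = k ->
  exists C : 'I_k.+1 -> {set fdart U},
    [/\ forall i i', i != i' -> [disjoint C i & C i'],
        \bigcup_i C i = star v0,
        forall i, C i != set0 /\ (C i \subset A \/ C i \subset B),
        compatible v0 C A B f & compatible v0 C A B g].
Proof.
move=> card_e; have cR : #|new_roots| = k.+1.
  have := card_new_roots; rewrite comps_avoid card_e.
  have : 0 < #|fvert U| by apply/card_gt0P; exists v0.
  lia.
pose r (i : 'I_k.+1) := enum_val (cast_ord (esym cR) i).
have r_inj : injective r by move=> i i' /enum_val_inj/cast_ord_inj.
have r_new i : r i \in new_roots by exact: enum_valP.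
have r_onto v : v \in new_roots -> exists i, r i = v.
  move=> vR; exists (cast_ord cR (enum_rank_in vR v)).
  by rewrite /r cast_ordK enum_rankK_in.
have old d : exists s, dpos s = inl d.
  by have [n <-] := dart_onto d; exists (old_dart n); rewrite dpos_old_dart.
have vpos_s d s : d \in star v0 -> dpos s = inl d -> vpos (fter s) = inr (leaf T d).
  by rewrite inE => /eqP d0 sd; rewrite vpos_fter sd d0 eqxx.
have new_s d s : d \in star v0 -> dpos s = inl d -> rt (fter s) \in new_roots.
  move=> ds sd; rewrite in_set roots_root // /is_old.
  have := connect_avoid_vpos (connect_root (dlink avoid) (fter s)).
  by rewrite (vpos_s d s ds sd); case: (vpos _).
pose C i := [set d in star v0 | [exists s, (dpos s == inl d) && (rt (fter s) == r i)]].
have CP i d s : d \in star v0 -> dpos s = inl d -> (d \in C i) = (rt (fter s) == r i).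
  move=> ds sd; rewrite in_set ds; apply/existsP/idP=> [[s']|si].
    by case/andP=> /eqP s'd; rewrite (dpos_old_inj sd s'd).
  by exists s; rewrite sd eqxx.
have C_star i d : d \in C i -> d \in star v0 by rewrite in_set => /andP[].
(* The component of [d] can be read off at any vertex [u] whose local star
   contains [d]. *)
have legC (Q : fin_graph) (q : hom Q U) (j : hom (deform T q) PT)
    (dpos_j : forall z, dpos (hd j z) = leg_dpos z) (u : fvert Q) t
    (u0 : is_v0_vertex v0 q u) (ut : t \in local_tree T q u) d i :
    d \in local_star v0 q u -> d \in same_side e t ->
    (d \in C i) = (rt (j (leg_vert u0 ut)) == r i).
  move=> du dt; have [s sd] := old d; rewrite (CP i d s) ?(local_star_star du) //.
  by rewrite (rootP avoid_sym (leg_avoid dpos_j u0 ut du dt sd)).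
(* The elements of a local star on one side of [e] have their leaves joined
   within the local tree without crossing [e]. *)
have C_comp (Q : fin_graph) (q : hom Q U) (j : hom (deform T q) PT) :
    (forall z, dpos (hd j z) = leg_dpos z) -> compatible v0 C A B q.
  move=> dpos_j u u0.
  have part (D : {set fdart U}) : (forall d d', d \in star v0 -> d' \in star v0 ->
      d \in D -> d' \in D -> d' \in same_side e (leaf T d)) ->
      local_star v0 q u :&: D = set0 \/ exists i, local_star v0 q u :&: D \subset C i.
    move=> D_half; case: (set_0Vmem (local_star v0 q u :&: D)) => [|[d /setIP[du dD]]].
      by left.
    right; have ds := local_star_star du; have [s sd] := old d.
    have [i ri] := r_onto _ (new_s d s ds sd); exists i.
    have di : d \in C i by rewrite (CP i d s ds sd) ri.
    apply/subsetP=> d' /setIP[d'u d'D]; have d's := local_star_star d'u.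
    have ut := leaf_local_tree T du.
    rewrite (legC _ q j dpos_j u _ u0 ut d' i) ?D_half //.
    by rewrite -(legC _ q j dpos_j u _ u0 ut d i) ?D_half.
  split; apply: part => d d' ds d's; rewrite ?A_side ?B_side // in_set d's /=.
    by move=> -> ->.
  by move=> /negPf-> /negPf->.
exists C; split.
- move=> i i' ii'; rewrite -setI_eq0; apply: contraR ii' => /set0Pn[d /setIP[di di']].
  have ds := C_star i d di; have [s sd] := old d.
  by move: di di'; rewrite !(CP _ d s ds sd) => /eqP-> /eqP/r_inj->.
- apply/setP=> d; apply/bigcupP/idP=> [[i _ /C_star]//|ds].
  have [s sd] := old d; have [i ri] := r_onto _ (new_s d s ds sd); exists i => //.
  by rewrite (CP i d s ds sd) ri.
- move=> i; have := r_new i; rewrite in_set /is_old => /andP[/eqP ri].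
  case vposi: (vpos (r i)) => [//|t] _; split.
    (* A local tree with a vertex in the component has a leaf in it as well. *)
    have legN (Q : fin_graph) (q : hom Q U) (j : hom (deform T q) PT)
        (dpos_j : forall z, dpos (hd j z) = leg_dpos z) (u : fvert Q)
        (u0 : is_v0_vertex v0 q u) (ut : t \in local_tree T q u) :
        r i = j (leg_vert u0 ut) -> C i != set0.
      move=> ru; have [d du dt] := same_side_nonempty e ut.
      by apply/set0Pn; exists d; rewrite (legC _ q j dpos_j u t u0 ut) // -ru ri.
    case: (po_vertP (r i)) => -[z rz]; move: vposi; rewrite rz ?vpos_inl ?vpos_inr;
      case: z rz => -[//|[u t']] zP rz [tt']; case/andP: (zP) => u0; rewrite tt' => ut.
      by apply: (legN _ _ _ dpos_inl u u0 ut); rewrite rz; congr (hv jX _);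
        apply: val_inj; rewrite /= tt'.
    by apply: (legN _ _ _ dpos_inr u u0 ut); rewrite rz; congr (hv jY _);
        apply: val_inj; rewrite /= tt'.
  (* The side of [e] is constant on components. *)
  have tC d : d \in C i -> (leaf T d \in side e) = (t \in side e).
    move=> di; have ds := C_star i d di; have [s sd] := old d.
    have := connect_avoid_vpos (connect_root (dlink avoid) (fter s)).
    by move: di; rewrite (CP i d s ds sd) (vpos_s d s ds sd) => /eqP->; rewrite vposi.
  have [te|te] := boolP (t \in side e); [left|right]; apply/subsetP=> d di.
    by rewrite A_side ?tC // (C_star i).
  by rewrite B_side ?tC // (C_star i).
- exact: C_comp dpos_inl.
- exact: C_comp dpos_inr.
Qed.

End ClassesFromComponents.

End Cut.

End DeformedPushout.

(** * The criterion *)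

Lemma card_sig_sum (A B : finType) (p : pred (A + B)) :
  #|{: {z | p z}}| = #|[pred x | p (inl x)]| + #|[pred y | p (inr y)]|.
Proof. by rewrite card_sig -!sum1_card big_sumType. Qed.

Lemma rbar_deform_U (U : fin_graph) (v0 : fvert U) (T : deformation_tree v0) :
  rbar (deform_U T) = rbar U.
Proof.
have cv : #|fvert (deform_U T)| = #|fvert U|.-1 + #|fvert T|.
  rewrite card_sig_sum -(cardC1 v0); congr addn.
  have <- : #|[predX pred1 v0 & fvert T]| = #|fvert T| by rewrite cardX card1 mul1n.
  by apply: eq_card => -[u t]; rewrite !inE /= in_setT.
have cd : #|fdart (deform_U T)| = #|fdart U| + #|fdart T|.
  rewrite card_sig_sum; congr addn.
  have <- : #|[predX pred1 v0 & fdart T]| = #|fdart T| by rewrite cardX card1 mul1n.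
  by apply: eq_card => -[u t]; rewrite !inE /= !in_setT.
rewrite /rbar cv cd; have := card_tree (tree_is_tree T).
have : 0 < #|fvert U| by apply/card_gt0P; exists v0.
have := card_inv_closed (@inv_closedT T); rewrite cardsT.
have := card_inv_closed (@inv_closedT U); rewrite cardsT.
lia.
Qed.

Section Criterion.
Variables (U W X Y : fin_graph) (a : hom W X) (b : hom W Y).
Variables (f : hom X U) (g : hom Y U).
Hypothesis sq : hom_eq (hom_comp f a) (hom_comp g b).
Hypothesis vert_glued : forall n n', sum_hv f g n = sum_hv f g n' ->
  glued_class (a : fvert W -> fvert X) (b : fvert W -> fvert Y) n = glued_class _ _ n'.
Hypothesis vert_onto : forall u, exists n, sum_hv f g n = u.
Hypothesis dart_glued : forall e e', sum_hd f g e = sum_hd f g e' ->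
  glued_class (hd a : fdart W -> fdart X) (hd b : fdart W -> fdart Y) e
  = glued_class _ _ e'.
Hypothesis dart_onto : forall d, exists e, sum_hd f g e = d.
Hypothesis X_dart : forall x : fvert X, exists d : fdart X, fter d = x.
Hypothesis Y_dart : forall y : fvert Y, exists d : fdart Y, fter d = y.
Hypothesis W_dart : forall w : fvert W, exists d : fdart W, fter d = w.
Variable v0 : fvert U.

(** The statement for arbitrary maps [f] and [g] whose pushout is [U]. *)
Lemma deformation_criterion :
  (forall T : deformation_tree v0,
     rbar (pushout (deform_square T sq)) = rbar (deform_U T) /\
     rbar (deform_U T) = rbar U) <->
  (forall A B : {set fdart U},
     A != set0 -> B != set0 -> [disjoint A & B] -> A :|: B = star v0 ->
     exists C : 'I_(n_comp (@type_edge _ _ _ _ a b f g v0 A B) predT).+1 -> {set fdart U},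
       [/\ (forall i j, i != j -> [disjoint C i & C j]),
           \bigcup_i C i = star v0,
           (forall i, C i != set0 /\ (C i \subset A \/ C i \subset B)),
           compatible v0 C A B f & compatible v0 C A B g]).
Proof.
split=> [rT A B A0 B0 AB ABs|cond T].
  have [T [e A_side]] := double_star_exists A0 B0 AB ABs.
  have B_side d : d \in star v0 -> (d \in B) = (leaf T d \notin side e).
    move=> ds; rewrite -A_side //; move: ds; rewrite -ABs inE.
    by have := disjointFr AB (x := d); case: (d \in A) => //= -> //.
  have [rP rU] := rT T; rewrite rU in rP.
  move/(rbar_po sq dart_glued dart_onto T): rP => forest_count.
  apply: (exists_classes vert_glued vert_onto dart_glued dart_onto
    X_dart Y_dart W_dart A_side B_side forest_count).
  by rewrite (n_comp_type_edge sq A_side B_side).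
split; last exact: rbar_deform_U.
rewrite rbar_deform_U; apply/(rbar_po sq dart_glued dart_onto T).
have Fclosed := tree_darts_closed (sq := sq) (T := T).
have cF := comps_tree_darts sq vert_glued vert_onto X_dart Y_dart W_dart T.
rewrite -cF; apply: (comps_forest Fclosed) => d dF.
have [e de] : exists e, dpos d = inr e.
  by move: dF; rewrite in_set; case: (dpos d) => // e; exists e.
pose A := [set d in star v0 | leaf T d \in side e].
pose B := [set d in star v0 | leaf T d \notin side e].
have A_side c : c \in star v0 -> (c \in A) = (leaf T c \in side e).
  by move=> cs; rewrite in_set cs.
have B_side c : c \in star v0 -> (c \in B) = (leaf T c \notin side e).
  by move=> cs; rewrite in_set cs.
have leaf_in e' : exists2 c, c \in star v0 & leaf T c \in side e'.
  have [t te] := side_leaf (tree_is_tree T) e'.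
  by rewrite leafP => /imsetP[c cs def_t]; exists c; rewrite -?def_t.
have A0 : A != set0.
  by have [c cs ce] := leaf_in e; apply/set0Pn; exists c; rewrite A_side.
have B0 : B != set0.
  have [c cs] := leaf_in (finv e); rewrite side_inv; last exact: tree_is_tree.
  by move=> ce; apply/set0Pn; exists c; rewrite B_side.
have AB : [disjoint A & B].
  rewrite -setI_eq0; apply/eqP/setP=> c; rewrite !inE.
  by case: (leaf T c \in _); rewrite !andbF.
have ABs : A :|: B = star v0.
  by apply/setP=> c; rewrite in_setU !in_set -andb_orr orbN andbT.
have [C [C_disj C_star C_part C_f C_g]] := cond A B A0 B0 AB ABs.
have Cs i : C i \subset star v0 by rewrite -C_star; exact: bigcup_sup.
have := leq_comps_avoid sq vert_onto dart_onto X_dart Y_dart A_side B_side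
  C_disj Cs (fun i => (C_part i).1) C_f C_g.
rewrite (n_comp_type_edge sq A_side B_side) avoid_darts => le.
apply: (bridge_of_comps Fclosed (cut_closed (sq := sq) e) (cut_sub sq e)).
  by rewrite cF card_cut; lia.
by rewrite inE [X in X || _]in_set de eqxx.
Qed.

End Criterion.

(** No vertex of a core is isolated. *)
Lemma core_has_dart (C : graph) (K : fin_graph) (c : hom K C) PV PD :
  embeds_onto c PV PD ->
  (forall v, PV v -> exists2 e, PD e & ini e = v) ->
  forall u : fvert K, exists d : fdart K, fter d = u.
Proof.
case=> c_inj _ cV cD has u.
have [e /cD[d <-]] := has (c u) ((cV _).2 (ex_intro _ u erefl)).
by rewrite hom_ini => /c_inj du; exists (finv d); rewrite fter_inv.
Qed.

Theorem theorem5p1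
  (U : fin_graph)
  (U_connected : connected U)
  (U_degree : forall u : fvert U, degree u != 1)
  (o : fvert U)
  (H K : pi1 o -> Prop)
  (H_subgroup : subgroup H) (K_subgroup : subgroup K)
  (H_fg : fin_generated H) (K_fg : fin_generated K)
  (X : stallings H) (Y : stallings K)
  (SHK S1 : pi1 o -> Prop)
  (S_reps : dcoset_reps H K SHK)
  (S1_sub : forall s, S1 s -> SHK s)
  (S1_nonempty : exists s, S1 s)
  (W : fiber_core X Y S1)
  (Z : stallings (join_group H K S1))
  (PZU : P_eq_Z_eq_U W Z)
  (v0 : fvert U) :
  (forall T : deformation_tree v0,
     rbar (deform_P T W) = rbar (deform_U T) /\ rbar (deform_U T) = rbar U)
  <->
  (forall A B : {set fdart U},
     A != set0 -> B != set0 -> [disjoint A & B] -> A :|: B = star v0 ->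
     exists C : 'I_(psi_components W v0 A B).+1 -> {set fdart U},
       [/\ (forall i j, i != j -> [disjoint C i & C j]),
           \bigcup_i C i = star v0,
           (forall i, C i != set0 /\ (C i \subset A \/ C i \subset B)),
           compatible v0 C A B (stallings_map X) &
           compatible v0 C A B (stallings_map Y)]).
Proof.
case: PZU => -[gamma [natX natY [[gv gvK gvK'] [gd gdK gdK']]]].
case=> [[zv zvK zvK'] [zd zdK zdK']].
(* The Stallings maps of [X] and [Y] factor through the isomorphism from the
   pushout to [U], because natural maps commute with the covering maps. *)
have natE (L : pi1 o -> Prop) (Q : stallings L) (j : hom Q (pushout_P W)) :
    natural_map (hom_comp gamma j) ->
    (forall x, stallings_map Q x = stallings_map Z (gamma (j x))) /\
    (forall d, hd (stallings_map Q) d = hd (stallings_map Z) (hd gamma (hd j d))).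
  case=> c [_ [cv cd] [cjv cjd]]; split=> x.
    exact: etrans (esym (cv _)) (congr1 (hv (cover_map Z)) (cjv x)).
  exact: etrans (esym (cd _)) (congr1 (hd (cover_map Z)) (cjd x)).
have [Xv Xd] := natE _ _ _ natX; have [Yv Yd] := natE _ _ _ natY.
have vE n : sum_hv (stallings_map X) (stallings_map Y) n
    = stallings_map Z (gamma (glued_class _ _ n : fvert (pushout_P W))).
  by case: n => x; [exact: Xv|exact: Yv].
have dE n : sum_hd (stallings_map X) (stallings_map Y) n
    = hd (stallings_map Z) (hd gamma (glued_class _ _ n : fdart (pushout_P W))).
  by case: n => x; [exact: Xd|exact: Yd].
apply: (deformation_criterion (alpha_square W)).
- by move=> n n'; rewrite !vE => /(can_inj zvK)/(can_inj gvK).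
- move=> u; exists (val (gv (zv u) : fvert (pushout_P W))).
  by rewrite vE glued_classK gvK' zvK'.
- by move=> n n'; rewrite !dE => /(can_inj zdK)/(can_inj gdK).
- move=> d; exists (val (gd (zd d) : fdart (pushout_P W))).
  by rewrite dE glued_classK gdK' zdK'.
- exact: core_has_dart (core_inP X) (fun _ => id).
- exact: core_has_dart (core_inP Y) (fun _ => id).
apply: core_has_dart (fiber_inP W) _ => v [[e ecore <-] sv].
by exists e.
Qed.
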